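(* If $\Gamma$ is a primitive commutative weakly distance-regular digraph of valency $3$ and girth more than $2$, then $\Gamma$ is isomorphic to one of the following digraphs: $\mathrm{Cay}(\mathbb{Z}_{7},\{1,2,4\})$; $\mathrm{Cay}(\mathbb{Z}_{13},\{1,3,9\})$; or $\mathrm{Cay}(\mathbb{Z}_{n}\times\mathbb{Z}_{n},\{(1,0),(0,1),(n-1,n-1)\})$ for some positive integer $n\notin 3\mathbb{Z}\setminus\{3\}$.
   Context: Digraphs are finite and simple (no loops, no multiple arcs). For a digraph $\Gamma$ with vertex set $V\Gamma$, $\partial(x,y)$ is the length of a shortest directed path from $x$ to $y$; $\Gamma$ is strongly connected if there is a directed path from every vertex to every other vertex. The two way distance is $\widetilde{\partial}(x,y)=(\partial(x,y),\partial(y,x))$, $\widetilde{\partial}(\Gamma)=\{\widetilde{\partial}(x,y)\mid x,y\in V\Gamma\}$, and $\Gamma_{\widetilde{i}}=\{(x,y)\mid\widetilde{\partial}(x,y)=\widetilde{i}\}$. A strongly connected digraph $\Gamma$ is weakly distance-regular if for all $\widetilde{h},\widetilde{i},\widetilde{j}\in\widetilde{\partial}(\Gamma)$ the number $p_{\widetilde{i},\widetilde{j}}^{\widetilde{h}}=|\{z\in V\Gamma\mid \widetilde{\partial}(x,z)=\widetilde{i},\ \widetilde{\partial}(z,y)=\widetilde{j}\}|$ is the same for all pairs $(x,y)$ with $\widetilde{\partial}(x,y)=\widetilde{h}$. It is commutative if $p_{\widetilde{i},\widetilde{j}}^{\widetilde{h}}=p_{\widetilde{j},\widetilde{i}}^{\widetilde{h}}$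 for all $\widetilde{h},\widetilde{i},\widetilde{j}$, and primitive if the digraph $(V\Gamma,\Gamma_{\widetilde{i}})$ is strongly connected for every $\widetilde{i}\in\widetilde{\partial}(\Gamma)\setminus\{(0,0)\}$. Valency means the common out-degree (= in-degree). The girth is the minimum length of a directed circuit (a pair of opposite arcs is a circuit of length $2$). For a group $G$ and $S\subseteq G$, $\mathrm{Cay}(G,S)$ is the digraph with vertex set $G$ and arcs $(x,y)$ with $x^{-1}y\in S$. *)

(* Defs.v *)
From HB Require Import structures.
From mathcomp Require Import all_boot all_order all_algebra all_fingroup.

Set Implicit Arguments.
Unset Strict Implicit.
Unset Printing Implicit Defensive.

Section Digraph.
Variables (V : finType) (e : rel V).

Definition walk_of_length (x y : V) (k : nat) : bool :=
  [exists p : k.-tuple V, path e x p && (last x p == y)].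

(* A shortest path has fewer than #|V| arcs, so searching below #|V| is enough;
   the value is #|V| exactly when y cannot be reached from x (see dist_min and
   dist_attained). *)
Definition dist (x y : V) : nat := find (walk_of_length x y) (iota 0 #|V|).

Definition dist2 (x y : V) : nat * nat := (dist x y, dist y x).

Definition dist2_set (i : nat * nat) : Prop := exists x y : V, dist2 x y = i.

Definition dist2_rel (i : nat * nat) : rel V := [rel x y | dist2 x y == i].

Definition inter_count (x y : V) (i j : nat * nat) : nat :=
  #|[set z : V | (dist2 x z == i) && (dist2 z y == j)]|.

Definition circuit_of_length (k : nat) : bool :=
  [exists c : k.-tuple V, ucycleb e c].

(* Searches the lengths 1, ..., #|V|; the value is #|V|.+1 (standing for an
   infinite girth) exactly when there is no circuit (see girth_min and
   girth_attained). *)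
Definition girth : nat := (find circuit_of_length (iota 1 #|V|)).+1.

Definition has_valency (k : nat) : Prop :=
  forall x : V, #|[set y | e x y]| = k /\ #|[set y | e y x]| = k.

End Digraph.

(* As usual for graphs, the vertex set is required to be nonempty; simplicity
   amounts to irreflexivity, since a relation has no multiple arcs. *)
Definition simple_digraph (V : finType) (e : rel V) : Prop :=
  0 < #|V| /\ irreflexive e.

Definition strongly_connected (V : finType) (e : rel V) : Prop :=
  forall x y : V, connect e x y.

Definition weakly_distance_regular (V : finType) (e : rel V) : Prop :=
  strongly_connected e /\
  forall h i j : nat * nat,
    dist2_set e h -> dist2_set e i -> dist2_set e j ->
    forall x y x' y' : V, dist2 e x y = h -> dist2 e x' y' = h ->
    inter_count e x y i j = inter_count e x' y' i j.

(* For a weakly distance-regular digraph, inter_count e x y i j is the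
   intersection number p^h_(i,j), for any x and y with dist2 e x y = h. *)
Definition commutative_digraph (V : finType) (e : rel V) : Prop :=
  forall h i j : nat * nat,
    dist2_set e h -> dist2_set e i -> dist2_set e j ->
    forall x y : V, dist2 e x y = h ->
    inter_count e x y i j = inter_count e x y j i.

Definition primitive_digraph (V : finType) (e : rel V) : Prop :=
  forall i : nat * nat, dist2_set e i -> i <> (0, 0) ->
  strongly_connected (dist2_rel e i).

Definition digraph_iso (V W : finType) (e : rel V) (e' : rel W) : Prop :=
  exists2 f : V -> W, bijective f & forall x y : V, e' (f x) (f y) = e x y.

Definition Cay (gT : finGroupType) (S : {set gT}) : rel gT :=
  [rel x y | (x^-1 * y)%g \in S].

Definition Cay7 : rel 'Z_7 := @Cay 'Z_7 [set 1%R; 2%:R%R; 4%:R%R].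

Definition Cay13 : rel 'Z_13 := @Cay 'Z_13 [set 1%R; 3%:R%R; 9%:R%R].

(* For n > 0, 'I_n.-1.+1 is the group of integers mod n, including n = 1 (which
   'Z_n does not cover), and inZp is the reduction mod n; n = 0 is a junk case. *)
Definition CayZnZn (n : nat) : rel ('I_n.-1.+1 * 'I_n.-1.+1)%type :=
  Cay [set (inZp 1, inZp 0); (inZp 0, inZp 1); (inZp (n - 1), inZp (n - 1))].
Arguments CayZnZn n _ _ : clear implicits.

Section Facts.
Variables (V : finType) (e : rel V).

Lemma walk_of_lengthP (x y : V) (k : nat) :
  reflect (exists p, [/\ path e x p, last x p = y & size p = k])
          (walk_of_length e x y k).
Proof.
apply: (iffP existsP) => [[p /andP[pp /eqP lp]]|[p [pp lp /eqP sp]]].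
  by exists p; rewrite size_tuple.
by exists (Tuple sp); rewrite /= pp lp /=.
Qed.

Lemma dist_min (x : V) (p : seq V) : path e x p -> dist e x (last x p) <= size p.
Proof.
move=> pp; rewrite leqNgt; apply/negP => lt_p.
have lt_pV : size p < #|V|.
  by apply: leq_trans lt_p _; rewrite -[X in _ <= X](size_iota 0) find_size.
have := before_find 0 lt_p; rewrite nth_iota // add0n.
by move/walk_of_lengthP; case; exists p.
Qed.

Lemma dist_attained (x y : V) : connect e x y ->
  exists p, [/\ path e x p, last x p = y & size p = dist e x y].
Proof.
case/connectP => p /shortenP[q pq uq _] ->; apply/walk_of_lengthP.
have lt_qV : size q < #|V|.
  by have /card_uniqP sq := uq; rewrite -[(size q).+1]sq max_card.
have hasq : has (walk_of_length e x (last x q)) (iota 0 #|V|).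
  apply/hasP; exists (size q); first by rewrite mem_iota.
  by apply/walk_of_lengthP; exists q.
have := nth_find 0 hasq; rewrite nth_iota //.
by rewrite -{2}(size_iota 0 #|V|) -has_find.
Qed.

Lemma circuit_of_lengthP (k : nat) :
  reflect (exists2 c, ucycle e c & size c = k) (circuit_of_length e k).
Proof.
apply: (iffP existsP) => [[c uc]|[c uc /eqP sc]]; last by exists (Tuple sc).
by exists c; rewrite ?size_tuple.
Qed.

Lemma size_ucycle (c : seq V) : ucycle e c -> size c <= #|V|.
Proof. by case/andP => _ /card_uniqP <-; apply: max_card. Qed.

Lemma girth_min (c : seq V) : ucycle e c -> 0 < size c -> girth e <= size c.
Proof.
move=> uc c_gt0; rewrite leqNgt; apply/negP; rewrite /girth ltnS => le_c.
have lt_c : (size c).-1 < find (circuit_of_length e) (iota 1 #|V|).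
  by rewrite prednK.
have := before_find 0 lt_c; rewrite nth_iota ?prednK ?size_ucycle //.
by rewrite add1n prednK // => /circuit_of_lengthP[]; exists c.
Qed.

Lemma girth_attained (c : seq V) : ucycle e c -> 0 < size c ->
  exists2 c', ucycle e c' & size c' = girth e.
Proof.
move=> uc c_gt0; apply/circuit_of_lengthP.
have hasc : has (circuit_of_length e) (iota 1 #|V|).
  apply/hasP; exists (size c); last by apply/circuit_of_lengthP; exists c.
  by rewrite mem_iota c_gt0 add1n ltnS size_ucycle.
have := nth_find 0 hasc; rewrite nth_iota ?add1n //.
by rewrite -{2}(size_iota 1 #|V|) -has_find.
Qed.

End Facts.

Lemma CayZnZnE (n : nat) (x y : 'I_n.-1.+1 * 'I_n.-1.+1) :
  CayZnZn n x y = ((y.1 - x.1, y.2 - x.2)%R \in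
    [set (inZp 1, inZp 0); (inZp 0, inZp 1); (inZp (n - 1), inZp (n - 1))]).
Proof.
rewrite /CayZnZn /Cay /=.
by rewrite [(y.1 - _)%R]GRing.addrC [(y.2 - _)%R]GRing.addrC.
Qed.

Lemma Cay7E (x y : 'Z_7) :
  Cay7 x y = ((y - x)%R \in [set 1%R; 2%:R%R; 4%:R%R]).
Proof. by rewrite /Cay7 /Cay /= GRing.addrC. Qed.

Lemma Cay13E (x y : 'Z_13) :
  Cay13 x y = ((y - x)%R \in [set 1%R; 3%:R%R; 9%:R%R]).
Proof. by rewrite /Cay13 /Cay /= GRing.addrC. Qed.

(* Main.v *)
(* Functions of two vertices that depend only on the two-way distance are closed
   under products, and these commute. Primitivity excludes nontrivial relations of
   valency 1 or 2, so two vertices have at most one common out-neighbour; counting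
   2- and 3-step walks then shows that the common out-neighbour of two
   out-neighbours of x is an in-neighbour of x. So the digraph is locally the
   triangular lattice spanned by three directions a, b, c with a + b + c = 0.
   The numbers of straight walks of length m are the power sums a^m + b^m + c^m,
   hence class functions by Newton's identities, although the directions have as
   yet no global names. Therefore straight walks close in all directions at once,
   which kills the holonomy of the directions and makes the digraph a Cayley digraph
   of an abelian group generated by a, b, c; by primitivity its exponent is a prime N.
   If its order is N^2, this is the grid. If its order is N, the power sums show that
   a, b, c are 1, w, w^2 with w^2 + w + 1 = 0 mod N, and unless N is 7 or 13 the
   vertices 2 + w and -(2 + w) have the same two-way distance from 0, which the power
   sum of exponent 2 + w forbids. *)

Require Import Defs.
From HB Require Import structures.
From mathcomp Require Import all_boot all_order all_algebra all_fingroup.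
From mathcomp Require Import cyclic zify ring.

Set Implicit Arguments.
Unset Strict Implicit.
Unset Printing Implicit Defensive.

(** * Class functions *)

Section ClassFunctions.
Variables (V : finType) (e : rel V).

(** The obstacle is that regularity only speaks of counts: no automorphism is given, and a single
    direction is not a class function, only symmetric functions of the three directions are. The
    leverage comes from small valencies: an irreflexive class relation with at most two successors
    per vertex is empty, so no class relation can properly split another one of valency at most
    five. Power sums are the symmetric functions of choice because their supports still show where
    individual straight walks end. Translations are built as permutations of frames, that is of
    vertices with named out-neighbours, since on vertices alone a direction could come back under
    another name; local relations make these permutations commute before anything global is known.
    The orders 7 and 13 are the primes above 6 among the norms of the few Eisenstein integers that
    the final distance comparison has to keep away from zero. *)

Definition class_fun (T : Type) (M : V -> V -> T) : Prop :=
  forall x y x' y', dist2 e x y = dist2 e x' y' -> M x y = M x' y'.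

Definition conv (M N : V -> V -> nat) (x y : V) : nat :=
  \sum_z M x z * N z y.

Lemma class_fun_comp (T U : Type) (h : T -> U) (M : V -> V -> T) :
  class_fun M -> class_fun (fun x y => h (M x y)).
Proof. by move=> cM x y x' y' /cM ->. Qed.

Lemma class_fun_comp2 (T U W : Type) (h : T -> U -> W)
    (M : V -> V -> T) (N : V -> V -> U) :
  class_fun M -> class_fun N -> class_fun (fun x y => h (M x y) (N x y)).
Proof. by move=> cM cN x y x' y' E; rewrite (cM _ _ _ _ E) (cN _ _ _ _ E). Qed.

Lemma class_fun_tr (T : Type) (M : V -> V -> T) :
  class_fun M -> class_fun (fun x y => M y x).
Proof. by move=> cM x y x' y' [E1 E2]; apply: cM; rewrite /dist2 E1 E2. Qed.

Lemma class_fun_ext (T : Type) (M N : V -> V -> T) :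
  (forall x y, M x y = N x y) -> class_fun M -> class_fun N.
Proof. by move=> MN cM x y x' y' /cM; rewrite !MN. Qed.

Lemma class_fun_factor (M : V -> V -> nat) :
  class_fun M -> exists m, forall x y, M x y = m (dist2 e x y).
Proof.
move=> cM.
exists (fun i => if [pick p : V * V | dist2 e p.1 p.2 == i] is Some p
                 then M p.1 p.2 else 0).
move=> x y; case: pickP => [p /eqP /cM -> //|/(_ (x, y)) /=].
by rewrite eqxx.
Qed.

Lemma leq_dist (x y : V) : dist e x y < #|V|.+1.
Proof. by rewrite ltnS -[X in _ <= X](size_iota 0) find_size. Qed.

(** Distances are at most [#|V|], so two-way distances are indexed by a finite type over which sums
    can run. *)
Definition dist2_ord (x y : V) : 'I_#|V|.+1 * 'I_#|V|.+1 :=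
  (Ordinal (leq_dist x y), Ordinal (leq_dist y x)).

Lemma conv_inter_count (M N : V -> V -> nat) (m n : nat * nat -> nat) (x y : V) :
  (forall x y, M x y = m (dist2 e x y)) ->
  (forall x y, N x y = n (dist2 e x y)) ->
  let nat_pair (i : 'I_#|V|.+1 * 'I_#|V|.+1) := (val i.1, val i.2) in
  conv M N x y = \sum_i \sum_j
    inter_count e x y (nat_pair i) (nat_pair j) * (m (nat_pair i) * n (nat_pair j)).
Proof.
move=> Mm Nn nat_pair; rewrite pair_big /= /conv.
rewrite (partition_big (fun z => (dist2_ord x z, dist2_ord z y)) xpredT) //=.
apply: eq_bigr => -[i j] _ /=.
rewrite (eq_bigr (fun _ => m (nat_pair i) * n (nat_pair j))); last first.
  by move=> z /eqP[<- <-]; rewrite Mm Nn.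
rewrite sum_nat_const; congr (_ * _).
rewrite /inter_count -cardsE; apply: eq_card => z; rewrite !inE /=.
by case: i j => [[i i1] [i' i2]] [[j j1] [j' j2]].
Qed.

Hypothesis e_wdr : weakly_distance_regular e.

Lemma inter_count_class (i j : nat * nat) :
  class_fun (fun x y => inter_count e x y i j).
Proof.
move=> x y x' y' E.
(* Regularity is assumed only for distances i and j that occur; a nonzero count shows that they
   do. *)
have pos u v : 0 < inter_count e u v i j -> dist2_set e i /\ dist2_set e j.
  case/card_gt0P => z; rewrite inE => /andP[/eqP ui /eqP vj].
  by split; [exists u, z | exists z, v].
have main : dist2_set e i -> dist2_set e j ->
    inter_count e x y i j = inter_count e x' y' i j.
  move=> si sj; case: e_wdr => _ reg.
  by apply: (reg (dist2 e x y)) => //; exists x, y.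
case: (posnP (inter_count e x y i j)) => [x0|/pos[si sj]]; last exact: main.
case: (posnP (inter_count e x' y' i j)) => [-> //|/pos[si sj]]; exact: main.
Qed.

Lemma class_fun_conv (M N : V -> V -> nat) :
  class_fun M -> class_fun N -> class_fun (conv M N).
Proof.
move=> /class_fun_factor[m Mm] /class_fun_factor[n Nn] x y x' y' E.
rewrite !(conv_inter_count _ _ Mm Nn) /=.
apply: eq_bigr => i _; apply: eq_bigr => j _.
by rewrite (inter_count_class _ _ E).
Qed.

Hypothesis e_comm : commutative_digraph e.

Lemma convC (M N : V -> V -> nat) (x y : V) :
  class_fun M -> class_fun N -> conv M N x y = conv N M x y.
Proof.
move=> /class_fun_factor[m Mm] /class_fun_factor[n Nn].
rewrite (conv_inter_count _ _ Mm Nn) (conv_inter_count _ _ Nn Mm) exchange_big.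
apply: eq_bigr => i _; apply: eq_bigr => j _.
rewrite [n _ * m _]mulnC; congr (_ * _).
set a := (_, val j.2); set b := (_, val i.2).
have pos u v : 0 < inter_count e x y u v -> dist2_set e u /\ dist2_set e v.
  case/card_gt0P => z; rewrite inE => /andP[/eqP ui /eqP vj].
  by split; [exists x, z | exists z, y].
have main u v : dist2_set e u -> dist2_set e v ->
    inter_count e x y u v = inter_count e x y v u.
  by move=> su sv; apply: (e_comm (h := dist2 e x y)) => //; exists x, y.
case: (posnP (inter_count e x y a b)) => [ab0|/pos[sa sb]]; last exact: main.
case: (posnP (inter_count e x y b a)) => [-> //|/pos[sb sa]]; exact: main.
Qed.

Lemma dist_self (x : V) : dist e x x = 0.
Proof. by have /= := @dist_min _ e x [::] isT; rewrite leqn0 => /eqP. Qed.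

Lemma dist_eq0 (x y : V) : dist e x y = 0 -> x = y.
Proof.
by case: e_wdr => /(_ x y) /dist_attained[p [_ <- <-]] _ /size0nil ->.
Qed.

Lemma class_fun_diag (T : Type) (M : V -> V -> T) (x y : V) :
  class_fun M -> M x x = M y y.
Proof. by apply; rewrite /dist2 !dist_self. Qed.

Lemma class_fun_eq : class_fun (fun x y : V => x == y).
Proof.
have eqE x y : (x == y) = (dist e x y == 0).
  by apply/eqP/eqP => [->|/dist_eq0 //]; rewrite dist_self.
by move=> x y x' y' [E _]; rewrite !eqE E.
Qed.

Lemma dist_eq1 (x y : V) : x != y -> (dist e x y == 1) = e x y.
Proof.
move=> xy; apply/eqP/idP => [|exy].
  case: e_wdr => /(_ x y) /dist_attained[p [+ + <-]] _.
  by case: p => [|z [|]] //=; rewrite andbT => ? <-.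
apply/eqP; rewrite eqn_leq lt0n.
have -> /= : dist e x y != 0 by apply: contra_neq xy => /dist_eq0.
by rewrite andbT; apply: (@dist_min _ e x [:: y]); rewrite /= exy.
Qed.

Hypothesis e_irr : irreflexive e.

Lemma arc_neq (x y : V) : e x y -> x != y.
Proof. by apply: contraTneq => ->; rewrite e_irr. Qed.

Lemma class_fun_arc : class_fun (fun x y => e x y).
Proof.
have eE x y : e x y = (x != y) && (dist e x y == 1).
  by case: eqVneq => [->|/dist_eq1 ->]; rewrite ?e_irr.
apply: (class_fun_ext (fun x y => esym (eE x y))).
apply: (class_fun_comp2 (fun a b => ~~ a && b)); first exact: class_fun_eq.
by move=> x y x' y' [-> _].
Qed.

Definition degree (r : rel V) (x : V) : nat := #|[set y | r x y]|.

Lemma degree_sum (r : rel V) (x : V) : degree r x = \sum_y r x y.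
Proof. by rewrite /degree cardsE -sum1_card big_mkcond. Qed.

Lemma class_fun_degree (r : rel V) (x y : V) :
  class_fun r -> degree r x = degree r y.
Proof.
move=> cr; rewrite !degree_sum.
have D z : \sum_y r z y = conv (fun x y => r x y) (fun _ _ => 1) z z.
  by apply: eq_bigr => u _; rewrite muln1.
rewrite !D; apply: (class_fun_diag (M := conv _ _)); apply: class_fun_conv => //.
exact: (class_fun_comp nat_of_bool).
Qed.

Lemma class_fun_nat (r : rel V) : class_fun r -> class_fun (fun x y => r x y : nat).
Proof. exact: (class_fun_comp nat_of_bool). Qed.

(** Out- and in-degree are the diagonal entries of the two products of [r] with its transpose, and
    these products commute. *)
Lemma degree_in (r : rel V) (x : V) :
  class_fun r -> degree (fun x y => r y x) x = degree r x.
Proof.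
move=> cr; have cr' := class_fun_tr cr; rewrite !degree_sum.
have := convC x x (class_fun_nat cr) (class_fun_nat cr').
rewrite /conv => E; transitivity (\sum_z r z x * r z x).
  by apply: eq_bigr => z _; rewrite mulnb andbb.
by rewrite -E; apply: eq_bigr => z _; rewrite mulnb andbb.
Qed.

Lemma conv_card (r s : rel V) (x y : V) :
  conv (fun x y => r x y) (fun x y => s x y) x y = #|[set z | r x z && s z y]|.
Proof.
by rewrite cardsE -sum1_card [RHS]big_mkcond; apply: eq_bigr => z _; rewrite mulnb.
Qed.

Hypothesis e_prim : primitive_digraph e.

(** A class relation that holds for one pair contains the whole distance class of that pair, which
    primitivity makes strongly connected. *)
Lemma class_fun_connect (r : rel V) (x y u v : V) :
  class_fun r -> x != y -> r x y -> connect r u v.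
Proof.
move=> cr xy rxy.
have xy_nz : dist2 e x y <> (0, 0) by case=> /dist_eq0 E _; rewrite E eqxx in xy.
have xy_in : dist2_set e (dist2 e x y) by exists x, y.
apply: connect_sub (e_prim xy_in xy_nz u v) => a b /= /eqP /cr rab.
by apply: connect1; rewrite rab.
Qed.

(** * Relations of small valency *)

Hypothesis e_val : has_valency e 3.

Lemma class_fun_iter (r : rel V) (s : V -> V) (k : nat) :
  class_fun r -> (forall x y, r x y = (s x == y)) ->
  class_fun (fun x y => iter k s x == y).
Proof.
move=> cr rE; elim: k => [|k IHk] /=; first exact: class_fun_eq.
have cc := class_fun_conv (class_fun_nat IHk) (class_fun_nat cr).
apply: class_fun_ext (class_fun_comp (fun n => n == 1) cc) => x y.
rewrite /conv (bigD1 (iter k s x)) //= eqxx mul1n big1 => [|z /negPf]; last first.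
  by rewrite eq_sym => ->.
by rewrite addn0 eqb1 rE.
Qed.

(* A nontrivial relation of valency one would make every relation thin; a
   shortest circuit through an arc of minimal type is then the orbit of a single
   permutation, and any other arc shortens it. *)
Lemma degree_le1_diag (r : rel V) (x y : V) :
  class_fun r -> (forall u, degree r u <= 1) -> r x y -> x = y.
Proof.
move=> cr r1 rxy; apply/eqP/negPn/negP => xy.
have deg1 u : degree r u = 1.
  apply/eqP; rewrite eqn_leq r1 (class_fun_degree u x cr) /degree.
  by apply/card_gt0P; exists y; rewrite inE.
pose s u := odflt u [pick v | r u v].
have rE u v : r u v = (s u == v).
  have /eqP/cards1P[w rw] := deg1 u.
  have ruE z : r u z = (z == w) by rewrite -in_set1 -rw inE.
  rewrite /s; case: pickP => [z|/(_ w)]; last by rewrite ruE eqxx.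
  by rewrite !ruE => /eqP ->; rewrite eq_sym.
have [p0 ep0] : exists p : V * V, e p.1 p.2.
  have : 0 < #|[set z | e x z]| by rewrite (e_val x).1.
  by case/card_gt0P => z; rewrite inE => exz; exists (x, z).
case: (@arg_minnP _ p0 (fun p => e p.1 p.2) (fun p => dist e p.2 p.1) ep0)
  => -[x0 y0] /= exy0 min_d.
set g := dist e y0 x0 in min_d.
have xy0 := arc_neq exy0.
pose c u v := dist2 e u v == dist2 e x0 y0.
have cc : class_fun c by move=> a b a' b' E; rewrite /c E.
(* The graph of [s] is connected by primitivity, so some power of [s] maps x0 to y0; as a class
   function it then agrees with the whole type [c] of this arc. *)
have [k kE] : exists k, iter k s x0 = y0.
  have : fconnect s x0 y0.
    rewrite -(eq_connect rE); exact: (class_fun_connect _ _ cr xy rxy).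
  by move/iter_findex => <-; exists (findex s x0 y0).
pose t := iter k s.
have cE u v : c u v = (t u == v).
  have cst a b : c a b -> t a == b.
    move=> /eqP /(class_fun_iter k cr rE) ->; exact/eqP.
  apply/idP/idP => [/cst //|/eqP tuv].
  have : 0 < degree c u.
    rewrite (class_fun_degree u x0 cc); apply/card_gt0P.
    by exists y0; rewrite inE /c eqxx.
  case/card_gt0P => w; rewrite inE => cuw; have /eqP := cst _ _ cuw.
  by rewrite tuv => ->.
have [p [pp lp sp]] := dist_attained (e_wdr.1 y0 x0).
(* Each arc of the circuit has a return path of length [g] along the circuit and, by minimality, no
   shorter one, so it has the type of (x0, y0). *)
have cpath p2 : forall p1, p1 ++ p2 = p -> path c (last y0 p1) p2.
  elim: p2 => // v p2 IHp p1 pE; rewrite -cat_rcons in pE.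
  rewrite [path _ _ _]/= -{2}(last_rcons y0 p1 v) IHp // andbT.
  move: pp lp sp; rewrite -pE cat_path last_cat last_rcons rcons_path size_cat.
  case/andP => /andP[pp1 ev] pp2 lp2; rewrite size_rcons => sp2.
  have : dist e v (last y0 p1) <= g.
    have := @dist_min _ e v (p2 ++ y0 :: p1).
    rewrite cat_path last_cat /= lp2 exy0 pp1 pp2 size_cat /= => /(_ isT).
    by rewrite /g -sp2; lia.
  have := min_d (last y0 p1, v) ev => /= g1 g2.
  have dE : dist e v (last y0 p1) = g by apply/eqP; rewrite eqn_leq g1 g2.
  have d1 a b : e a b -> dist e a b = 1.
    by move=> eab; apply/eqP; rewrite dist_eq1 // arc_neq.
  by rewrite /c /dist2 dE (d1 _ _ ev) (d1 _ _ exy0) eqxx.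
have fp : fpath t y0 p.
  by have := cpath p [::] erefl; rewrite (eq_path cE).
have tx0 : t x0 = y0 by apply/eqP; rewrite -cE /c.
have pT : y0 :: p = traject t y0 (size p).+1.
  by move/fpathP: fp => [n ->]; rewrite size_traject trajectS.
have x0E : iter (size p) t y0 = x0.
  by rewrite -lp; move/fpathP: fp => [n ->]; rewrite size_traject last_traject.
have loop m : iter m t y0 \in y0 :: p.
  rewrite pT; move: m; apply/loopingP.
  by rewrite /looping iterS x0E tx0 inE eqxx.
have [z exz /andP[zy zx]] : exists2 z, e x0 z & (z != y0) && (z != x0).
  have : 0 < #|[set z | e x0 z] :\ y0|.
    by have := (e_val x0).1; rewrite (cardsD1 y0) inE exy0; lia.
  case/card_gt0P => z; rewrite !inE => /andP[zy exz].
  by exists z => //; rewrite zy eq_sym arc_neq.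
have : z \in y0 :: p.
  have : fconnect t x0 z.
    rewrite -(eq_connect cE); apply: (class_fun_connect _ _ cc xy0).
    by rewrite /c.
  move/iter_findex => <-; rewrite -x0E -iterD; exact: loop.
rewrite inE (negPf zy) /= => /path.splitPr pE.
case: pE pp lp sp => p1 p2; rewrite cat_path /= last_cat /= size_cat /=.
case/and3P => _ _ pp2 lp2 sp.
(* z comes after y0 on the circuit, so it returns to x0 faster than y0 does. *)
have := min_d (x0, z) exz => /=; have := dist_min pp2; rewrite lp2 /g -sp.
by lia.
Qed.

Lemma degree_le1_empty (r : rel V) (x y : V) :
  class_fun r -> irreflexive r -> (forall u, degree r u <= 1) -> r x y = false.
Proof.
move=> cr ir r1; apply/negP => rxy.
by have xy := degree_le1_diag cr r1 rxy; rewrite xy ir in rxy.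
Qed.

Definition ball (r : rel V) (x : V) (k : nat) : {set V} :=
  iter k (fun B => B :|: [set y | [exists z in B, r z y]]) [set x].

Lemma ballS (r : rel V) (x : V) (k : nat) :
  ball r x k.+1 = ball r x k :|: [set y | [exists z in ball r x k, r z y]].
Proof. by []. Qed.

Lemma class_fun_ball (r : rel V) (k : nat) :
  class_fun r -> class_fun (fun x y => y \in ball r x k).
Proof.
move=> cr; elim: k => [|k IHk].
  by apply: class_fun_ext class_fun_eq => x y; rewrite in_set1 eq_sym.
have cc := class_fun_conv (class_fun_nat IHk) (class_fun_nat cr).
apply: class_fun_ext (class_fun_comp2 (fun a n => a || (0 < n)) IHk cc) => x y.
rewrite conv_card ballS !inE; congr (_ || _).
apply/card_gt0P/existsP => -[z]; first by rewrite inE; exists z.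
by exists z; rewrite inE.
Qed.

(* A symmetric relation of valency two is a polygon, whose spheres have at most
   two points; then no relation has valency above two. *)
Lemma sym_degree_le2_empty (r : rel V) (x y : V) :
  class_fun r -> irreflexive r -> symmetric r -> (forall u, degree r u <= 2) ->
  r x y = false.
Proof.
move=> cr ir sr r2; apply/negP => rxy.
have xy : x != y by apply: contraTneq rxy => ->; rewrite ir.
pose D k u := ball r u k.+1 :\: ball r u k.
have D2 u k : #|D k u| <= 2.
  elim: k => [|k Dk].
    apply: leq_trans (r2 u); apply/subset_leq_card/subsetP => v.
    rewrite /D ballS !inE; case: eqP => //= _ /existsP[z].
    by rewrite inE => /andP[/eqP ->].
  apply: leq_trans Dk.
  have nearer v : v \in D k.+1 u -> exists2 z, z \in D k u & r z v.
    rewrite /D [ball r u k.+2]ballS inE => /andP[v1]; rewrite inE (negPf v1) /=.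
    rewrite inE => /existsP[z /andP[zk rzv]]; exists z => //.
    rewrite inE zk andbT; apply: contra v1 => zk'.
    by rewrite ballS !inE; apply/orP; right; apply/existsP; exists z; rewrite zk'.
  pose f v := odflt v [pick z in D k u | r z v].
  have fP v : v \in D k.+1 u -> f v \in D k u /\ r (f v) v.
    move=> /nearer[z zD rzv]; rewrite /f; case: pickP => [w /andP[]//|/(_ z)].
    by rewrite zD rzv.
  (* [f] is injective: [f v] also has a neighbour closer to u, which uses up one of its at most two
     neighbours. *)
  rewrite -(card_in_imset (f := f)); last first.
    move=> v w /[dup] vD /fP[fD rv] /[dup] wD /fP[_ rw] fE; rewrite -fE in rw.
    have [z zk rz] : exists2 z, z \in ball r u k & r (f v) z.
      move: fD; rewrite inE ballS => /andP[nk]; rewrite inE (negPf nk) inE.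
      by move=> /existsP[z /andP[zk rz]]; exists z => //; rewrite sr.
    have far t : t \in D k.+1 u -> t != z.
      rewrite inE ballS => /andP[+ _]; apply: contraNneq => ->.
      by rewrite inE zk.
    apply/eqP/negPn/negP => vw.
    have : #|[set z; v; w]| <= 2.
      apply: leq_trans (r2 (f v)); apply/subset_leq_card/subsetP => t.
      by rewrite !inE => /orP[/orP[]|] /eqP ->.
    by rewrite -setUA cardsU1 cards2 vw !inE !(eq_sym z) !(negPf (far _ _)).
  apply/subset_leq_card/subsetP => _ /imsetP[v /fP[vD _] ->]; exact: vD.
have [z exz] : exists z, e x z.
  have : 0 < #|[set z | e x z]| by rewrite (e_val x).1.
  by case/card_gt0P => z; rewrite inE; exists z.
pose c u v := dist2 e u v == dist2 e x z.
have cc : class_fun c by move=> a b a' b' E; rewrite /c E.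
have ic : irreflexive c.
  move=> u; apply/negP => /eqP[xz0 _]; rewrite dist_self in xz0.
  by have := arc_neq exz; rewrite (dist_eq0 (esym xz0)) eqxx.
have [k kz] : exists k, z \in D k x.
  have : exists k, z \in ball r x k.
    have /connectP[p] := class_fun_connect x z cr xy rxy.
    elim/last_ind: p z {exz c cc ic} => [|p w IHp] z.
      by move=> _ ->; exists 0; rewrite inE.
    rewrite rcons_path last_rcons => /andP[pp rw] ->.
    have [k kp] := IHp _ pp erefl; exists k.+1; rewrite ballS !inE.
    by apply/orP; right; apply/existsP; exists (last x p); rewrite kp.
  move=> exk; case: (ex_minnP exk) => -[|k] zk kmin.
    by move: (arc_neq exz); move: zk; rewrite inE eq_sym => ->.
  exists k; rewrite inE zk andbT; apply/negP => /kmin; by rewrite ltnn.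
(* The type of an arc lies in a single sphere of the polygon. *)
have c2 u : degree c u <= 2.
  apply: leq_trans (D2 u k); apply/subset_leq_card/subsetP => v; rewrite inE.
  have cD : class_fun (fun u v => v \in D k u).
    apply: class_fun_ext (class_fun_comp2 (fun a b => ~~ a && b)
      (class_fun_ball k cr) (class_fun_ball k.+1 cr)) => a b.
    by rewrite /D in_setD.
  by rewrite /c => /eqP /cD ->.
have ce u v : c u v -> e u v by move=> /eqP /class_fun_arc ->.
have cxz : c x z by rewrite /c.
have cN u : 1 < degree c u.
  rewrite (class_fun_degree u x cc) ltnNge; apply/negP => c1.
  have := @degree_le1_empty c x z cc ic.
  by rewrite cxz => H; suff : true = false by []; apply: H => v;
     rewrite (class_fun_degree v x cc).
(* The arcs outside [c] have valency 3 - 2 = 1, which is already excluded. *)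
pose b u v := e u v && ~~ c u v.
have cb : class_fun b.
  exact: (class_fun_comp2 (fun a b => a && ~~ b) class_fun_arc cc).
have deg u : degree b u = 1.
  have := cardsID [set v | c u v] [set v | e u v]; rewrite (e_val u).1.
  have -> : [set v | e u v] :&: [set v | c u v] = [set v | c u v].
    by apply/setIidPr/subsetP => v; rewrite !inE; apply: ce.
  have -> : [set v | e u v] :\: [set v | c u v] = [set v | b u v].
    by apply/setP => v; rewrite !inE andbC.
  by have := c2 u; have := cN u; rewrite /degree; lia.
have /card_gt0P[v] : 0 < degree b x by rewrite deg.
rewrite inE (degree_le1_empty _ _ cb) // => [u|u]; last by rewrite deg.
by rewrite /b e_irr.
Qed.

(** For valency exactly two, each successor of u has just one further predecessor, so sharing a
    successor is a symmetric relation of valency at most two. *)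
Lemma degree_le2_empty (r : rel V) (x y : V) :
  class_fun r -> irreflexive r -> (forall u, degree r u <= 2) -> r x y = false.
Proof.
move=> cr ir r2; have [r1|] := boolP [forall u, degree r u <= 1].
  by apply: degree_le1_empty => // u; exact: (forallP r1).
rewrite negb_forall => /existsP[w]; rewrite -ltnNge => w2.
have deg2 u : degree r u = 2.
  by apply/eqP; rewrite eqn_leq r2 (class_fun_degree u w cr).
have cr' := class_fun_tr cr.
pose q u v := (u != v) && [exists z, r u z && r v z].
have cq : class_fun q.
  have cc := class_fun_conv (class_fun_nat cr) (class_fun_nat cr').
  apply: class_fun_ext (class_fun_comp2 (fun a n => ~~ a && (0 < n)) class_fun_eq cc).
  move=> u v; rewrite conv_card; congr (_ && _).
  apply/card_gt0P/existsP => -[z]; first by rewrite inE; exists z.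
  by exists z; rewrite inE.
have iq : irreflexive q by move=> u; rewrite /q eqxx.
have sq : symmetric q.
  move=> u v; rewrite /q eq_sym; congr (_ && _).
  by apply: eq_existsb => z; rewrite andbC.
have other u z : r u z -> degree (fun z v => (v != u) && r v z) z = 1.
  move=> ruz; have := degree_in z cr; rewrite deg2 /degree.
  rewrite (cardsD1 u) inE ruz => -[<-]; rewrite /= add0n.
  by apply: eq_card => v; rewrite !inE.
have q2 u : degree q u <= 2.
  rewrite -(deg2 u) !degree_sum.
  pose s z v := (v != u) && r v z.
  have -> : \sum_z r u z = \sum_z \sum_v r u z * s z v.
    apply: eq_bigr => z _; rewrite -big_distrr /= -degree_sum.
    by case ruz: (r u z); rewrite ?mul0n // other.
  rewrite exchange_big; apply: leq_sum => v _; rewrite /q.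
  case: eqP => //= uv; case: existsP => //= -[z /andP[uz vz]].
  by rewrite (bigD1 z) //= uz /s vz eq_sym; case: eqP uv.
have [z ryz] : exists z, r x z.
  have : 0 < degree r x by rewrite deg2.
  by case/card_gt0P => z; rewrite inE; exists z.
have : 0 < degree (fun z v => (v != x) && r v z) z by rewrite other.
case/card_gt0P => v; rewrite inE => /andP[vx rvz].
have := sym_degree_le2_empty x v cq iq sq q2.
by rewrite /q eq_sym vx /= => /existsP[]; exists z; rewrite ryz.
Qed.

(** Nonempty irreflexive class relations have valency at least three, so [s] cannot cut [r] into two
    nonempty parts. *)
Lemma class_fun_sub (r s : rel V) (x y u v : V) :
  class_fun r -> class_fun s -> irreflexive r -> (forall w, degree r w <= 5) ->
  r x y -> s x y -> r u v -> s u v.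
Proof.
move=> cr cs ir r5 rxy sxy ruv; apply/negPn/negP => nsuv.
have ct := class_fun_comp2 (fun a b => a && b) cr cs.
have cb := class_fun_comp2 (fun a b => a && ~~ b) cr cs.
set t := fun x y => r x y && s x y in ct; set b := fun x y => r x y && ~~ s x y in cb.
have large (q : rel V) a c w : class_fun q -> (forall z, q z z = false) ->
    q a c -> 2 < degree q w.
  move=> cq iq qac; rewrite ltnNge; apply/negP => q2.
  have /negP[] : ~~ q a c by rewrite (degree_le2_empty _ _ cq) // => z;
    rewrite (class_fun_degree z w cq).
  exact: qac.
have it z : t z z = false by rewrite /t ir.
have ib z : b z z = false by rewrite /b ir.
have := large t x y u ct it; rewrite /t rxy sxy => /(_ isT) t3.
have := large b u v u cb ib; rewrite /b ruv nsuv => /(_ isT) b3.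
have := cardsID [set v | s u v] [set v | r u v].
have -> : [set v | r u v] :&: [set v | s u v] = [set v | t u v].
  by apply/setP => z; rewrite !inE.
have -> : [set v | r u v] :\: [set v | s u v] = [set v | b u v].
  by apply/setP => z; rewrite !inE andbC.
by have := r5 u; move: t3 b3; rewrite /degree /t /b; lia.
Qed.

Definition common (r : rel V) (x y : V) : nat := #|[set z | r x z && r y z]|.

Lemma common_sym (r : rel V) (x y : V) : common r x y = common r y x.
Proof. by apply: eq_card => z; rewrite !inE andbC. Qed.

Lemma common_conv (r : rel V) (x y : V) :
  common r x y = conv (fun x y => r x y) (fun x y => r y x) x y.
Proof. by rewrite conv_card. Qed.

Lemma class_fun_common (r : rel V) : class_fun r -> class_fun (common r).
Proof.
move=> cr; have cr' := class_fun_tr cr.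
apply: class_fun_ext (class_fun_conv (class_fun_nat cr) (class_fun_nat cr')).
by move=> x y; rewrite common_conv.
Qed.

Lemma common_in (r : rel V) (x y : V) :
  class_fun r -> common (fun x y => r y x) x y = common r x y.
Proof.
move=> cr; have cr' := class_fun_tr cr.
by rewrite !common_conv convC //; apply: class_fun_nat.
Qed.

(** * Common successors in a relation of valency three *)

Section Valency3.
Variable r : rel V.
Hypothesis cr : class_fun r.
Hypothesis r3 : forall x, degree r x = 3.

(** The relation [r] is left open: the counts are needed for the arcs and again for [diamond]. *)
Definition common_eq (j : nat) : rel V := fun x y => (x != y) && (common r x y == j).

Lemma class_fun_common_eq (j : nat) : class_fun (common_eq j).
Proof.
exact: (class_fun_comp2 (fun a n => ~~ a && (n == j)) class_fun_eq
          (class_fun_common cr)).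
Qed.

(** There are 9 walks from x going one step along [r] and one step against it; 3 of them return to
    x. *)
Lemma common_eq_count (x : V) :
  degree (common_eq 1) x + 2 * degree (common_eq 2) x + 3 * degree (common_eq 3) x = 6.
Proof.
have : \sum_y common r x y = 9.
  have -> : \sum_y common r x y = \sum_z r x z * \sum_y r y z.
    transitivity (\sum_y \sum_z r x z * r y z).
      by apply: eq_bigr => y _; rewrite common_conv.
    by rewrite exchange_big; apply: eq_bigr => z _; rewrite big_distrr.
  rewrite (eq_bigr (fun z => r x z * 3)) => [|z _].
    by rewrite -big_distrl /= -degree_sum r3.
  by rewrite -(r3 z) -(degree_in z cr) degree_sum.
rewrite (bigD1 x) //= [common r x x](_ : _ = 3); last first.
  by rewrite -(r3 x); apply: eq_card => z; rewrite !inE andbb.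
rewrite (eq_bigr (fun y => common_eq 1 x y + 2 * common_eq 2 x y + 3 * common_eq 3 x y)).
  have S j : \sum_(y | y != x) common_eq j x y = degree (common_eq j) x.
    by rewrite degree_sum [RHS](bigD1 x) //= /common_eq eqxx.
  have Sk k j : \sum_(y | y != x) k * common_eq j x y = k * degree (common_eq j) x.
    by rewrite -S big_distrr.
  by rewrite 2!(@big_split nat 0 addn) S !Sk /=; lia.
move=> y yx; rewrite /common_eq eq_sym yx /=.
have : common r x y <= 3.
  by rewrite -(r3 x); apply/subset_leq_card/subsetP => z; rewrite !inE => /andP[].
by case: (common r x y) => [|[|[|[|]]]].
Qed.

Hypothesis V_gt4 : 4 < #|V|.

Lemma common_eq_irr (j : nat) : irreflexive (common_eq j).
Proof. by move=> x; rewrite /common_eq eqxx. Qed.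

Lemma degree_common_eq3 (x : V) : degree (common_eq 3) x = 0.
Proof.
apply/eqP; rewrite cards_eq0; apply/eqP/setP => y; rewrite !inE.
apply: degree_le2_empty; [exact: class_fun_common_eq | exact: common_eq_irr|].
by move=> u; have := common_eq_count u; lia.
Qed.

(* Otherwise the vertices sharing two out-neighbours form a K_4, which primitivity
   makes the whole vertex set. *)
Lemma degree_common_eq2 (x : V) : degree (common_eq 2) x = 0.
Proof.
have le3 : degree (common_eq 2) x <= 3 by have := common_eq_count x; lia.
have c2 := @class_fun_common_eq 2.
case: (ltngtP (degree (common_eq 2) x) 3) le3 => // [lt3|eq3] _.
  apply/eqP; rewrite cards_eq0; apply/eqP/setP => y; rewrite !inE.
  apply: degree_le2_empty => // [|u]; first exact: common_eq_irr.
  by rewrite (class_fun_degree u x c2).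
have deg2 u : degree (common_eq 2) u = 3 by rewrite (class_fun_degree u x c2).
have deg1 u : degree (common_eq 1) u = 0.
  by have := common_eq_count u; rewrite deg2; lia.
(* Two pairs among the three successors of u meet, so v and w share a successor; sharing exactly one
   or three is excluded. *)
have trans u v w : common_eq 2 u v -> common_eq 2 u w -> v != w -> common_eq 2 v w.
  case/andP => _ /eqP uv /andP[_ /eqP uw] vw.
  have : 0 < common r v w.
    have := cardsUI [set z | r u z && r v z] [set z | r u z && r w z].
    have : #|[set z | r u z && r v z] :|: [set z | r u z && r w z]| <= 3.
      rewrite -(r3 u); apply/subset_leq_card/subsetP => z; rewrite !inE.
      by case: (r u z).
    have : #|[set z | r u z && r v z] :&: [set z | r u z && r w z]| <= common r v w.
      apply/subset_leq_card/subsetP => z; rewrite !inE.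
      by case: (r u z) => //=.
    by move: uv uw; rewrite /common; lia.
  have le : common r v w <= 3.
    by rewrite -(r3 v); apply/subset_leq_card/subsetP => z; rewrite !inE => /andP[].
  have ne j : degree (common_eq j) v = 0 -> common r v w != j.
    move/eqP; rewrite cards_eq0 => /eqP/setP/(_ w).
    by rewrite !inE /common_eq vw /= => ->.
  have := ne 1 (deg1 v); have := ne 3 (degree_common_eq3 v).
  rewrite /common_eq vw; move: le; by case: (common r v w) => [|[|[|[|]]]].
have [y xy] : exists y, common_eq 2 x y.
  have : 0 < degree (common_eq 2) x by rewrite deg2.
  by case/card_gt0P => y; rewrite inE; exists y.
have s2 : symmetric (common_eq 2).
  by move=> u v; rewrite /common_eq eq_sym common_sym.
pose S := x |: [set v | common_eq 2 x v].
have cS v : v \in S.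
  have /connectP[p] := class_fun_connect x v c2 (proj1 (andP xy)) xy.
  elim/last_ind: p v => [|p w IHp] v; first by move=> _ ->; rewrite setU11.
  rewrite rcons_path last_rcons => /andP[pp uw] ->.
  have := IHp _ pp erefl; move: uw; set u := last x p => uw.
  rewrite in_setU1 inE => /orP[/eqP ux|xu].
    by rewrite in_setU1 inE -ux uw orbT.
  have sub : S :\ u \subset [set v | common_eq 2 u v].
    apply/subsetP => z; rewrite !inE => /andP[zu /orP[/eqP ->|xz]].
      by rewrite s2.
    by apply: trans xu xz _; rewrite eq_sym.
  have /eqP E : S :\ u == [set v | common_eq 2 u v].
    rewrite eqEcard sub /=; have := deg2 u; rewrite /degree => ->.
    have := cardsD1 u S; rewrite /S cardsU1 !inE common_eq_irr.
    by have := deg2 x; rewrite /degree => ->; rewrite xu orbT; lia.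
  by have : w \in S :\ u; [rewrite E inE | rewrite in_setD1 => /andP[]].
have : #|V| <= #|S| by apply/subset_leq_card/subsetP => v _; apply: cS.
by rewrite cardsU1; have := deg2 x; rewrite /degree; lia.
Qed.

Lemma common_le1 (x y : V) : x != y -> common r x y <= 1.
Proof.
move=> xy; have le : common r x y <= 3.
  by rewrite -(r3 x); apply/subset_leq_card/subsetP => z; rewrite !inE => /andP[].
have ne j : degree (common_eq j) x = 0 -> common r x y != j.
  move/eqP; rewrite cards_eq0 => /eqP/setP/(_ y).
  by rewrite !inE /common_eq xy /= => ->.
have := ne 2 (degree_common_eq2 x); have := ne 3 (degree_common_eq3 x).
by move: le; case: (common r x y) => [|[|[|[|]]]].
Qed.

Lemma degree_common (x : V) : degree (common_eq 1) x = 6.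
Proof.
by have := common_eq_count x; rewrite degree_common_eq2 degree_common_eq3; lia.
Qed.

End Valency3.

Hypothesis e_girth : 2 < girth e.

Lemma arc_asym (x y : V) : e x y -> e y x = false.
Proof.
move=> exy; apply/negP => eyx; move: e_girth; rewrite ltnNge => /negP; apply.
apply: (@girth_min _ e [:: x; y]) => //.
by rewrite /ucycle /= exy eyx inE arc_neq.
Qed.

Lemma card_vertices (x : V) : 6 < #|V|.
Proof.
have := cardsUI [set y | e x y] [set y | e y x].
have -> : [set y | e x y] :&: [set y | e y x] = set0.
  by apply/setP => y; rewrite !inE; apply/negP => /andP[/arc_asym ->].
rewrite (e_val x).1 (e_val x).2 cards0 addn0 => E.
have := cardsU1 x ([set y | e x y] :|: [set y | e y x]).
rewrite E !inE e_irr /= => card7; rewrite -[7]card7.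
exact: max_card.
Qed.

Lemma arc_lin (x y z w : V) :
  e x z -> e y z -> e x w -> e y w -> x != y -> z = w.
Proof.
move=> xz yz xw yw xy; have V4 : 4 < #|V| by have := card_vertices x; lia.
have := common_le1 class_fun_arc (fun x => (e_val x).1) V4 xy.
by move/card_le1_eqP; apply; rewrite inE ?xz ?xw.
Qed.

(** By commutativity two vertices have as many common in-neighbours as common out-neighbours. *)
Lemma arc_co (x y z : V) : e x y -> e x z -> exists2 w, e y w & e z w.
Proof.
move=> xy xz; have : 0 < common e y z.
  rewrite -(common_in _ _ class_fun_arc); apply/card_gt0P.
  by exists x; rewrite inE xy.
by case/card_gt0P => w; rewrite inE => /andP[yw zw]; exists w.
Qed.

Definition out3 (r : rel V) (x a b c : V) : Prop :=
  [/\ a != b, a != c, b != c & forall y, r x y = [|| y == a, y == b | y == c]].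

Lemma out3_rel (r : rel V) (x a b c : V) :
  out3 r x a b c -> [/\ r x a, r x b & r x c].
Proof. by case=> _ _ _ rE; rewrite !rE !eqxx !orbT. Qed.

Lemma out3_rot (r : rel V) (x a b c : V) : out3 r x a b c -> out3 r x b c a.
Proof.
case=> ab ac bc rE; split; rewrite // ?(eq_sym _ a) // => y.
by rewrite rE; do 3!case: (y == _).
Qed.

Lemma out3_swap (r : rel V) (x a b c : V) : out3 r x a b c -> out3 r x b a c.
Proof. by case=> ab ac bc rE; split; rewrite // ?(eq_sym b) // => y; rewrite rE orbCA. Qed.

Lemma out3_set (r : rel V) (x a b c : V) :
  out3 r x a b c -> [set y | r x y] = [set a; b; c].
Proof. by case=> _ _ _ rE; apply/setP => y; rewrite !inE rE orbA. Qed.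

Lemma card_set3 (a b c : V) :
  a != b -> a != c -> b != c -> #|[set a; b; c]| = 3.
Proof. by move=> ab ac bc; rewrite -setUA cardsU1 cards2 !inE (negPf ab) (negPf ac) bc. Qed.

Lemma out3_degree (r : rel V) (x a b c : V) : out3 r x a b c -> degree r x = 3.
Proof.
by move=> xabc; rewrite /degree (out3_set xabc); case: xabc => *; apply: card_set3.
Qed.

Lemma out3_complete (r : rel V) (x a b c : V) : degree r x = 3 ->
  r x a -> r x b -> r x c -> a != b -> a != c -> b != c -> out3 r x a b c.
Proof.
move=> r3 xa xb xc ab ac bc; split=> // y.
have /eqP/setP/(_ y) : [set a; b; c] == [set y | r x y].
  rewrite eqEcard (card_set3 ab ac bc) [#|_|]r3 andbT.
  by apply/subsetP => z; rewrite !inE => /orP[/orP[]|] /eqP ->.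
by rewrite !inE -orbA.
Qed.

Lemma out3_third (r : rel V) (x a b : V) : degree r x = 3 ->
  r x a -> r x b -> a != b -> exists c, out3 r x a b c.
Proof.
move=> r3 xa xb ab; have : 0 < #|[set y | r x y] :\ a :\ b|.
  have := cardsD1 b ([set y | r x y] :\ a); have := cardsD1 a [set y | r x y].
  by move: r3; rewrite /degree !inE xa xb eq_sym ab /=; lia.
case/card_gt0P => c; rewrite !inE => /and3P[cb ca xc].
by exists c; apply: out3_complete => //; rewrite eq_sym.
Qed.

Lemma out3_exists (r : rel V) (x : V) : degree r x = 3 -> exists a b c, out3 r x a b c.
Proof.
move=> r3; have /card_gt0P[a] : 0 < degree r x by rewrite r3.
rewrite inE => xa; have : 0 < #|[set y | r x y] :\ a|.
  by have := cardsD1 a [set y | r x y]; move: r3; rewrite /degree !inE xa; lia.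
case/card_gt0P => b; rewrite !inE => /andP[ba xb].
have ab : a != b by rewrite eq_sym.
by have [c ?] := out3_third r3 xa xb ab; exists a, b, c.
Qed.

Lemma out3_count (r s : rel V) (x y a b c : V) :
  out3 r x a b c -> #|[set z | r x z && s z y]| = s a y + s b y + s c y.
Proof.
move=> [ab ac bc rE].
rewrite -sum1dep_card big_mkcondr /=.
rewrite (eq_bigl (mem (a |: (b |: [set c])))) => [|z]; last by rewrite !inE rE.
rewrite big_setU1 ?big_setU1 ?big_set1 ?inE ?(negPf ab) //= addnA.
by do 3!case: (s _ y).
Qed.

(** * The local structure *)

Definition paths2 (x y : V) : nat := #|[set z | e x z && e z y]|.

Lemma class_fun_paths2 : class_fun paths2.
Proof.
have ce := class_fun_nat class_fun_arc.
by apply: class_fun_ext (class_fun_conv ce ce) => x y; rewrite conv_card.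
Qed.

Lemma paths2_self (x : V) : paths2 x x = 0.
Proof.
apply/eqP; rewrite cards_eq0; apply/eqP/setP => y; rewrite !inE.
by apply/negP => /andP[/arc_asym ->].
Qed.

Lemma degree_arc (x : V) : degree e x = 3.
Proof. exact: (e_val x).1. Qed.

(** By [arc_lin] a vertex has at most one end of three 2-step walks, so these pairs form a class
    relation of valency at most one. It would lie on the diagonal, where [paths2] is 0. *)
Lemma arc_no3 (x a b c w : V) :
  out3 e x a b c -> e a w -> e b w -> e c w -> False.
Proof.
move=> xabc aw bw cw; pose r u v := paths2 u v == 3.
have cr : class_fun r by apply: class_fun_comp (fun n => n == 3) _ class_fun_paths2.
have rE u u1 u2 u3 v : out3 e u u1 u2 u3 -> r u v -> [/\ e u1 v, e u2 v & e u3 v].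
  by move=> /(out3_count e v) uE; rewrite /r /paths2 uE; do 3!case: (e _ v).
have r1 u : degree r u <= 1.
  have [u1 [u2 [u3 u123]]] := out3_exists (degree_arc u).
  apply/card_le1_eqP => v v'; rewrite !inE.
  move=> /(rE _ _ _ _ _ u123)[v1 v2 _] /(rE _ _ _ _ _ u123)[v1' v2' _].
  by case: u123 => u12 _ _ _; apply: arc_lin u12.
have rxw : r x w by rewrite /r /paths2 (out3_count _ _ xabc) aw bw cw.
by move: (rxw); rewrite -(degree_le1_diag cr r1 rxw) /r paths2_self.
Qed.

(* ab, ac, bc are the common out-neighbours of the pairs among a, b, c. *)
Definition hexagon (x a b c ab ac bc a' b' c' : V) : Prop :=
  [/\ out3 e x a b c, out3 e a ab ac a', out3 e b ab bc b' & out3 e c ac bc c'].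

Lemma hexagon_exists (x : V) :
  exists a b c ab ac bc a' b' c', hexagon x a b c ab ac bc a' b' c'.
Proof.
have [a [b [c xabc]]] := out3_exists (degree_arc x).
have [xa xb xc] := out3_rel xabc.
have [ab a_ab b_ab] := arc_co xa xb.
have [ac a_ac c_ac] := arc_co xa xc.
have [bc b_bc c_bc] := arc_co xb xc.
have ab_ac : ab != ac.
  by apply/eqP => E; rewrite -E in c_ac; apply: arc_no3 xabc a_ab b_ab c_ac.
have ab_bc : ab != bc.
  by apply/eqP => E; rewrite -E in c_bc; apply: arc_no3 xabc a_ab b_ab c_bc.
have ac_bc : ac != bc.
  by apply/eqP => E; rewrite -E in b_bc; apply: arc_no3 xabc a_ac b_bc c_ac.
have [a' aa] := out3_third (degree_arc a) a_ab a_ac ab_ac.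
have [b' bb] := out3_third (degree_arc b) b_ab b_bc ab_bc.
have [c' cc] := out3_third (degree_arc c) c_ac c_bc ac_bc.
by exists a, b, c, ab, ac, bc, a', b', c'.
Qed.

(** [diamondE] will identify this relation with the reversed arcs; until then it is only known as a
    class relation of valency three. *)
Definition diamond : rel V := fun x y => paths2 x y == 2.

Lemma class_fun_diamond : class_fun diamond.
Proof. exact: (class_fun_comp (fun n => n == 2) class_fun_paths2). Qed.

Lemma diamond_irr : irreflexive diamond.
Proof. by move=> x; rewrite /diamond paths2_self. Qed.

Lemma out3_diamond (x a b c ab ac bc a' b' c' : V) :
  hexagon x a b c ab ac bc a' b' c' -> out3 diamond x ab ac bc.
Proof.
move=> [xabc aa bb cc].
have [a_ab a_ac _] := out3_rel aa.
have [b_ab b_bc _] := out3_rel bb.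
have [c_ac c_bc _] := out3_rel cc.
have dE y : diamond x y = (e a y + e b y + e c y == 2).
  by rewrite /diamond /paths2 (out3_count _ _ xabc).
have nab : e c ab = false by apply/negP; exact: arc_no3 xabc a_ab b_ab.
have nac : e b ac = false by apply/negP => bac; exact: arc_no3 xabc a_ac bac c_ac.
have nbc : e a bc = false by apply/negP => abc; exact: arc_no3 xabc abc b_bc c_bc.
case: aa bb cc => ab_ac _ _ _ [ab_bc _ _ _] [ac_bc _ _ _]; split=> // y.
apply/idP/or3P => [|[/eqP ->|/eqP ->|/eqP ->]]; rewrite dE; last first.
- by rewrite b_bc c_bc nbc.
- by rewrite a_ac c_ac nac.
- by rewrite a_ab b_ab nab.
case: xabc => a_b a_c b_c _.
case ay: (e a y); case by_: (e b y); case cy: (e c y) => //= _.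
- by constructor 1; apply/eqP; apply: arc_lin a_b.
- by constructor 2; apply/eqP; apply: arc_lin a_c.
- by constructor 3; apply/eqP; apply: arc_lin b_c.
Qed.

Lemma degree_diamond (x : V) : degree diamond x = 3.
Proof.
have [a [b [c [ab [ac [bc [a' [b' [c' h]]]]]]]]] := hexagon_exists x.
exact: out3_degree (out3_diamond h).
Qed.

(** In the triangular lattice these are the six differences of two directions. *)
Definition adj : rel V := common_eq e 1.

Lemma class_fun_adj : class_fun adj.
Proof. exact: class_fun_common_eq class_fun_arc _. Qed.

Lemma vertices_gt4 (x : V) : 4 < #|V|.
Proof. by have := card_vertices x; lia. Qed.

Lemma degree_adj (x : V) : degree adj x = 6.
Proof.
exact: degree_common class_fun_arc degree_arc (vertices_gt4 x) x.
Qed.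

Lemma adjP (x y : V) : reflect (x != y /\ exists2 z, e x z & e y z) (adj x y).
Proof.
apply: (iffP andP) => -[xy].
  move=> /eqP c1; split=> //; have : 0 < common e x y by rewrite c1.
  by case/card_gt0P => z; rewrite inE => /andP[xz yz]; exists z.
move=> [z xz yz]; split=> //; rewrite eqn_leq.
rewrite (common_le1 class_fun_arc degree_arc (vertices_gt4 x) xy).
by apply/card_gt0P; exists z; rewrite inE xz.
Qed.

Lemma adj_in (x y z : V) : e z x -> e z y -> x != y -> adj x y.
Proof. by move=> zx zy xy; apply/adjP; split=> //; apply: arc_co zx zy. Qed.

Lemma adj_sym : symmetric adj.
Proof. by move=> x y; rewrite /adj /common_eq eq_sym common_sym. Qed.

Lemma adj_irr : irreflexive adj.
Proof. by move=> x; rewrite /adj /common_eq eqxx. Qed.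

(** Any two of [ab], [ac], [bc] have a common in-neighbour, so sharing a [diamond]-successor implies
    [adj]; both relations have valency six and hence coincide. *)
Lemma adj_diamond (x y : V) : adj x y -> exists2 z, diamond z x & diamond z y.
Proof.
move=> axy.
have dbl u v : common_eq diamond 1 u v -> exists2 z, diamond z u & diamond z v.
  rewrite /common_eq -common_in; last exact: class_fun_diamond.
  case/andP=> _ /eqP c1.
  have : 0 < common (fun x y => diamond y x) u v by rewrite c1.
  by case/card_gt0P => z; rewrite inE => /andP[]; exists z.
apply: (dbl).
have sub : [set v | common_eq diamond 1 x v] \subset [set v | adj x v].
  apply/subsetP => v; rewrite !inE => /[dup] /andP[xv _] /dbl[z zx zv].
  have [a [b [c [ab [ac [bc [a' [b' [c' h]]]]]]]]] := hexagon_exists z.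
  have [_ _ _ dE] := out3_diamond h.
  move: h => [_ /out3_rel[a1 a2 _] /out3_rel[b1 b2 _] /out3_rel[c1 c2 _]].
  move: zx zv xv; rewrite !dE => /or3P[] /eqP -> /or3P[] /eqP ->; rewrite ?eqxx //.
  - exact: adj_in a1 a2.
  - exact: adj_in b1 b2.
  - exact: adj_in a2 a1.
  - exact: adj_in c1 c2.
  - exact: adj_in b2 b1.
  - exact: adj_in c2 c1.
have /eqP/setP/(_ y) : [set v | common_eq diamond 1 x v] == [set v | adj x v].
  rewrite eqEcard sub [#|[set v | adj x v]|]degree_adj.
  rewrite [#|_|](degree_common class_fun_diamond degree_diamond) //.
  exact: vertices_gt4 x.
by rewrite !inE axy.
Qed.

Definition triples (x w : V) : nat := #|[set z | diamond x z && e z w]|.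

Lemma class_fun_triples : class_fun triples.
Proof.
have cc := class_fun_conv (class_fun_nat class_fun_diamond) (class_fun_nat class_fun_arc).
by apply: class_fun_ext cc => x y; rewrite conv_card.
Qed.

Lemma triplesC (x w : V) : triples x w = #|[set z | e x z && diamond z w]|.
Proof.
rewrite /triples -!conv_card convC //; apply: class_fun_nat => //.
  exact: class_fun_diamond.
exact: class_fun_arc.
Qed.

(* The common out-neighbour of all three diamond-neighbours of x is unique, so it
   defines a relation of valency at most one. *)
Lemma triples3_diag (x w : V) : triples x w = 3 -> x = w.
Proof.
move=> xw; pose r u v := triples u v == 3.
have cr : class_fun r := class_fun_comp (fun n => n == 3) class_fun_triples.
apply: (degree_le1_diag cr); last by rewrite /r xw.
move=> u; have [a [b [c [ab [ac [bc [a' [b' [c' h]]]]]]]]] := hexagon_exists u.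
have ud := out3_diamond h; apply/card_le1_eqP => v v'; rewrite !inE /r /triples.
rewrite !(out3_count _ _ ud) => E E'.
have [v1 v2] : e ab v /\ e ac v by move: E; do 3!case: (e _ v).
have [v1' v2'] : e ab v' /\ e ac v' by move: E'; do 3!case: (e _ v').
by case: ud => ab_ac _ _ _; apply: arc_lin ab_ac.
Qed.

(** * Excluding the non-flat case *)

Section NonFlat.
Hypothesis non_flat : forall x w, triples x w != 3.

(* Counting 3-step walks (arc, diamond) and (diamond, arc) alike forces each of
   a', b', c' to share an out-neighbour with every vertex of ab, ac, bc. *)
Lemma non_flat_adj (x a b c ab ac bc a' b' c' : V) :
  hexagon x a b c ab ac bc a' b' c' ->
  forall t, t \in [:: ab; ac; bc] -> [/\ adj t a', adj t b' & adj t c'].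
Proof.
move=> h; have ud := out3_diamond h.
have [xabc aa bb cc] := h.
have [a1 a2 a3] := out3_rel aa.
have [b1 b2 b3] := out3_rel bb.
have [c1 c2 c3] := out3_rel cc.
have [w1 ab_w1 ac_w1] := arc_co a1 a2.
have [w2 ab_w2 bc_w2] := arc_co b1 b2.
have [w3 ac_w3 bc_w3] := arc_co c1 c2.
have nf w : e ab w -> e ac w -> e bc w = false.
  move=> abw acw; apply/negP => bcw; have /negP[] := non_flat x w.
  by rewrite /triples (out3_count _ _ ud) abw acw bcw.
have n1 := nf _ ab_w1 ac_w1.
have n2 : e ac w2 = false by apply/negP => /(nf _ ab_w2); rewrite bc_w2.
have n3 : e ab w3 = false by apply/negP => /nf /(_ ac_w3); rewrite bc_w3.
have count w : e ab w + e ac w + e bc w =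
    (e ab w + e ac w + e a' w == 2) + (e ab w + e bc w + e b' w == 2)
    + (e ac w + e bc w + e c' w == 2).
  have := triplesC x w; rewrite /triples (out3_count _ _ ud) (out3_count _ _ xabc).
  by rewrite /diamond /paths2 (out3_count _ _ aa) (out3_count _ _ bb) (out3_count _ _ cc).
(* At w1 the left side of [count] is 2 and the first term on the right is at most 1, so b' or c' has
   to contribute. *)
have o1 : e b' w1 || e c' w1.
  by have := count w1; rewrite ab_w1 ac_w1 n1; do 3!case: (e _ w1).
have o2 : e a' w2 || e c' w2.
  by have := count w2; rewrite ab_w2 bc_w2 n2; do 3!case: (e _ w2).
have o3 : e a' w3 || e b' w3.
  by have := count w3; rewrite ac_w3 bc_w3 n3; do 3!case: (e _ w3).
have w12 : w1 != w2 by apply: contraFneq n2 => <-.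
have w13 : w1 != w3 by apply: contraFneq n3 => <-.
have w23 : w2 != w3 by apply: contraFneq n3 => <-.
have [_ ab_a' ac_a' _] := aa.
have [_ ab_b' bc_b' _] := bb.
have [_ ac_c' bc_c' _] := cc.
have a'_bc : bc != a'.
  by apply/eqP => E; rewrite -E in a3; apply: arc_no3 xabc a3 b2 c2.
have b'_ac : ac != b'.
  by apply/eqP => E; rewrite -E in b3; apply: arc_no3 xabc a2 b3 c1.
have c'_ab : ab != c'.
  by apply/eqP => E; rewrite -E in c3; apply: arc_no3 xabc a1 b1 c3.
(* By [arc_lin] each of a', b', c' serves only one of the two places open to it, so the three
   alternatives [o1], [o2], [o3] use all three vertices. *)
have x1 : e b' w1 -> e b' w3 = false.
  by move=> b'1; apply: contraNF w13 => b'3; apply/eqP; apply: arc_lin b'_ac.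
have x2 : e c' w1 -> e c' w2 = false.
  by move=> c'1; apply: contraNF w12 => c'2; apply/eqP; apply: arc_lin c'_ab.
have x3 : e a' w2 -> e a' w3 = false.
  by move=> a'2; apply: contraNF w23 => a'3; apply/eqP; apply: arc_lin a'_bc.
have adj_out w u v : u != v -> e u w -> e v w -> adj u v.
  by move=> uv uw vw; apply/adjP; split=> //; exists w.
have bc_adj : adj bc a'.
  have [m2|m2] := boolP (e a' w2); first exact: adj_out bc_w2 m2.
  have [m3|m3] := boolP (e a' w3); first exact: adj_out bc_w3 m3.
  rewrite (negPf m2) /= in o2; rewrite (negPf m3) /= in o3.
  by case/orP: o1 => [/x1|/x2]; rewrite ?o2 ?o3.
have ac_adj : adj ac b'.
  have [m1|m1] := boolP (e b' w1); first exact: adj_out ac_w1 m1.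
  have [m3|m3] := boolP (e b' w3); first exact: adj_out ac_w3 m3.
  rewrite (negPf m1) /= in o1; rewrite (negPf m3) orbF in o3.
  by case/orP: o2 => [/x3|]; rewrite ?o3 // x2.
have ab_adj : adj ab c'.
  have [m1|m1] := boolP (e c' w1); first exact: adj_out ab_w1 m1.
  have [m2|m2] := boolP (e c' w2); first exact: adj_out ab_w2 m2.
  rewrite (negPf m1) orbF in o1; rewrite (negPf m2) orbF in o2.
  by case/orP: o3; rewrite ?x1 ?x3.
move=> t; rewrite !inE => /or3P[] /eqP ->; split=> //.
- exact: adj_in a1 a3 _.
- exact: adj_in b1 b3 _.
- exact: adj_in a2 a3 _.
- exact: adj_in c1 c3 _.
- exact: adj_in b2 b3 _.
- exact: adj_in c2 c3 _.
Qed.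

Lemma hexagon_far_neq (x a b c ab ac bc a' b' c' : V) :
  hexagon x a b c ab ac bc a' b' c' -> [/\ a' != b', a' != c' & b' != c'].
Proof.
case=> [[a_b a_c b_c _] aa bb cc].
have [a1 a2 a3] := out3_rel aa.
have [b1 b2 b3] := out3_rel bb.
have [c1 c2 c3] := out3_rel cc.
case: aa bb cc => _ ab_a' ac_a' _ [_ ab_b' bc_b' _] [_ ac_c' bc_c' _]; split.
- by apply: contraNneq ab_a' => E; rewrite -E in b3; apply/eqP/(arc_lin a1 b1 a3 b3).
- by apply: contraNneq ac_a' => E; rewrite -E in c3; apply/eqP/(arc_lin a2 c1 a3 c3).
- by apply: contraNneq bc_b' => E; rewrite -E in c3; apply/eqP/(arc_lin b2 c2 b3 c3).
Qed.

Lemma hexagon_common (x a b c ab ac bc a' b' c' u v t : V) :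
  hexagon x a b c ab ac bc a' b' c' ->
  uniq [:: u; v; t] -> {subset [:: u; v; t] <= [:: ab; ac; bc]} ->
  t |: [set a'; b'; c'] \subset [set z | adj u z && adj v z] /\
  #|t |: [set a'; b'; c']| = 4.
Proof.
move=> h /and3P[]; rewrite !inE negb_or => /andP[uv ut] vt _ sub.
have [a'b' a'c' b'c'] := hexagon_far_neq h.
have H z : z \in [:: u; v; t] -> [/\ adj z a', adj z b' & adj z c'].
  by move=> /sub; apply: non_flat_adj h z.
have [ua ub uc] := H u (mem_head _ _).
have [va vb vc] : [/\ adj v a', adj v b' & adj v c'] by apply: H; rewrite !inE eqxx orbT.
have [ta tb tc] : [/\ adj t a', adj t b' & adj t c'] by apply: H; rewrite !inE eqxx !orbT.
have sib p q : p \in [:: ab; ac; bc] -> q \in [:: ab; ac; bc] -> p != q -> adj p q.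
  case: h => _ /out3_rel[a1 a2 _] /out3_rel[b1 b2 _] /out3_rel[c1 c2 _].
  rewrite !inE => /or3P[] /eqP -> /or3P[] /eqP -> //; rewrite ?eqxx //.
  - exact: adj_in a1 a2.
  - exact: adj_in b1 b2.
  - exact: adj_in a2 a1.
  - exact: adj_in c1 c2.
  - exact: adj_in b2 b1.
  - exact: adj_in c2 c1.
have su : u \in [:: ab; ac; bc] by apply: sub; rewrite mem_head.
have sv : v \in [:: ab; ac; bc] by apply: sub; rewrite !inE eqxx orbT.
have st : t \in [:: ab; ac; bc] by apply: sub; rewrite !inE eqxx !orbT.
split.
  apply/subsetP => z; rewrite !inE -!orbA => /or4P[] /eqP ->; rewrite ?ua ?ub ?uc //.
  by rewrite !sib.
rewrite cardsU1 card_set3 // !inE.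
have ne z : adj t z -> (t == z) = false.
  by move=> tz; apply: contraTF tz => /eqP <-; rewrite adj_irr.
by rewrite !ne.
Qed.

(** By [adj_diamond] every adjacent pair occurs as two of [ab], [ac], [bc] in some hexagon. *)
Lemma common_adj_ge4 (x y : V) : adj x y -> 3 < common adj x y.
Proof.
move=> /[dup] xy /adj_diamond[z zx zy].
have [a [b [c [ab [ac [bc [a' [b' [c' h]]]]]]]]] := hexagon_exists z.
have [ab_ac ab_bc ac_bc dE] := out3_diamond h.
have nxy : x != y by apply: contraTneq xy => ->; rewrite adj_irr.
have [t ut st] : exists2 t, uniq [:: x; y; t] & {subset [:: x; y; t] <= [:: ab; ac; bc]}.
  move: zx zy nxy; rewrite !dE => /or3P[] /eqP -> /or3P[] /eqP ->; rewrite ?eqxx // => _.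
  - exists bc; first by rewrite /= !inE negb_or ab_ac ab_bc ac_bc.
    by move=> v; rewrite !inE; do 3!case: (v == _).
  - exists ac; first by rewrite /= !inE negb_or ab_ac ab_bc eq_sym ac_bc.
    by move=> v; rewrite !inE; do 3!case: (v == _).
  - exists bc; first by rewrite /= !inE negb_or eq_sym ab_ac ab_bc ac_bc.
    by move=> v; rewrite !inE; do 3!case: (v == _).
  - exists ab; first by rewrite /= !inE negb_or ac_bc ![_ == ab]eq_sym ab_ac ab_bc.
    by move=> v; rewrite !inE; do 3!case: (v == _).
  - exists ac; first by rewrite /= !inE negb_or ![bc == _]eq_sym ab_ac ab_bc ac_bc.
    by move=> v; rewrite !inE; do 3!case: (v == _).
  - exists ab; first by rewrite /= !inE negb_or ![bc == _]eq_sym [ac == ab]eq_sym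
                                ab_ac ab_bc ac_bc.
    by move=> v; rewrite !inE; do 3!case: (v == _).
by have [/subset_leq_card + E] := hexagon_common h ut st; rewrite E.
Qed.

Lemma common_adj_le (x y : V) : adj x y ->
  [set z | adj x z && adj y z] \subset [set z | adj x z] :\ y.
Proof.
move=> xy; apply/subsetP => z; rewrite !inE => /andP[xz yz]; rewrite xz andbT.
by apply: contraTneq yz => ->; rewrite adj_irr.
Qed.

Lemma card_adjD1 (x y : V) : adj x y -> #|[set z | adj x z] :\ y| = 5.
Proof.
move=> xy; have := cardsD1 y [set z | adj x z].
by rewrite [#|[set z | adj x z]|]degree_adj inE xy => -[].
Qed.

(* Adjacent vertices with five common neighbours have the same closed
   neighbourhood, which by primitivity is then everything. *)
Lemma common_adj_neq5 (x y : V) : adj x y -> common adj x y != 5.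
Proof.
move=> xy; apply/negP => xy5.
pose q u v := adj u v && (common adj u v == 5).
have cq : class_fun q.
  exact: (class_fun_comp2 (fun a n => a && (n == 5)) class_fun_adj
            (class_fun_common class_fun_adj)).
pose nb u := u |: [set z | adj u z].
have nbq u v : q u v -> nb u = nb v.
  case/andP=> uv /eqP uv5.
  have half p r : adj p r -> common adj p r = 5 ->
      nb p = p |: (r |: [set z | adj p z && adj r z]).
    move=> pr c5; congr (_ |: _).
    have /eqP -> : [set z | adj p z && adj r z] == [set z | adj p z] :\ r.
      by rewrite eqEcard common_adj_le // card_adjD1 // [#|_|]c5.
    by rewrite setD1K // inE.
  have vu : adj v u by rewrite adj_sym.
  have vu5 : common adj v u = 5 by rewrite common_sym.
  rewrite (half u v uv uv5) (half v u vu vu5).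
  rewrite setUCA; congr (_ |: (_ |: _)).
  by apply/setP => z; rewrite !inE andbC.
have nxy : x != y by apply: contraTneq xy => ->; rewrite adj_irr.
have all_nb u v : v \in nb u.
  have /connectP[p] := class_fun_connect u v cq nxy (introT andP (conj xy xy5)).
  elim: p u => [|w p IHp] u /=; first by move=> _ ->; rewrite setU11.
  by case/andP => /nbq -> pp lp; apply: IHp.
(* There are at most 1 + 6 vertices, and u with its three out-neighbours and three in-neighbours
   already makes seven. *)
have all_arc u v : u != v -> e u v || e v u.
  move=> uv; apply/negPn/negP; rewrite negb_or => /andP[nuv nvu].
  have : #|[set: V]| <= 7.
    have /subset_leq_card : [set: V] \subset nb u by apply/subsetP => z _; apply: all_nb.
    by rewrite cardsU1 [#|[set z | adj u z]|]degree_adj inE adj_irr.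
  have : #|v |: (u |: ([set z | e u z] :|: [set z | e z u]))| <= #|[set: V]|.
    by apply/subset_leq_card/subsetP.
  rewrite !cardsU1 !inE eq_sym (negPf uv) (negPf nuv) (negPf nvu) e_irr /=.
  have := cardsUI [set y | e u y] [set y | e y u].
  have -> : [set y | e u y] :&: [set y | e y u] = set0.
    by apply/setP => z; rewrite !inE; apply/negP => /andP[/arc_asym ->].
  by rewrite (e_val u).1 (e_val u).2 cards0; lia.
have [a [b [c [ab [ac [bc [a' [b' [c' h]]]]]]]]] := hexagon_exists x.
have ud := out3_diamond h; have [d1 d2 d3] := out3_rel ud.
have [[a_b a_c b_c xE] aa bb cc] := h.
have [a1 a2 a3] := out3_rel aa.
have [b1 b2 b3] := out3_rel bb.
have [c1 c2 c3] := out3_rel cc.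
have x_ab : x != ab by apply: contraTneq d1 => <-; rewrite diamond_irr.
have d5 w : degree diamond w <= 5 by rewrite degree_diamond.
(* By [class_fun_sub] all of [diamond] lies in the arcs or in the reversed arcs. The former forces
   [ab = c] and [ac = b], hence opposite arcs between b and c; the latter gives
   [triples x x = 3]. *)
case/orP: (all_arc _ _ x_ab) => arc.
  have sub u v := class_fun_sub (u := u) (v := v) class_fun_diamond class_fun_arc
                    diamond_irr d5 d1 arc.
  have := sub _ _ d2; have := arc; rewrite !xE.
  rewrite ![_ == a]eq_sym (negPf (arc_neq a1)) (negPf (arc_neq a2)) /=.
  rewrite [ab == b]eq_sym (negPf (arc_neq b1)) /= => /eqP ab_c.
  rewrite [ac == c]eq_sym (negPf (arc_neq c1)) orbF => /eqP ac_b.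
  by move: (arc_asym b1); rewrite ab_c -ac_b c1.
have sub u v := class_fun_sub (u := u) (v := v) class_fun_diamond
  (class_fun_tr class_fun_arc) diamond_irr d5 d1 arc.
have /negP[] := non_flat x x.
by rewrite /triples (out3_count _ _ ud) arc (sub _ _ d2) (sub _ _ d3).
Qed.

(** Adjacent vertices would have exactly four common neighbours. The sixth neighbour s of [ab],
    besides [ac], [bc], a', b', c', is then adjacent to neither [ac] nor [bc], so s and [ab] have at
    most three. *)
Lemma non_flat_absurd (x : V) : False.
Proof.
have c4 u v : adj u v -> common adj u v = 4.
  move=> uv; have := common_adj_ge4 uv; have /eqP := common_adj_neq5 uv.
  have := subset_leq_card (common_adj_le uv); rewrite card_adjD1 // /common; lia.
have [a [b [c [ab [ac [bc [a' [b' [c' h]]]]]]]]] := hexagon_exists x.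
have [ab_ac ab_bc ac_bc _] := out3_diamond h.
have [sub1 card1] : bc |: [set a'; b'; c'] \subset [set z | adj ab z && adj ac z] /\
    #|bc |: [set a'; b'; c']| = 4.
  apply: hexagon_common h _ _; first by rewrite /= !inE negb_or ab_ac ab_bc ac_bc.
  by move=> v; rewrite !inE; do 3!case: (v == _).
have [sub2 card2] : ac |: [set a'; b'; c'] \subset [set z | adj ab z && adj bc z] /\
    #|ac |: [set a'; b'; c']| = 4.
  apply: hexagon_common h _ _; first by rewrite /= !inE negb_or ab_ac ab_bc eq_sym ac_bc.
  by move=> v; rewrite !inE; do 3!case: (v == _).
have [_ /out3_rel[a1 a2 _] /out3_rel[b1 b2 _] /out3_rel[c1 c2 _]] := h.
have adj1 : adj ab ac by apply: adj_in a1 a2 _.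
have adj2 : adj ab bc by apply: adj_in b1 b2 _.
have E1 : bc |: [set a'; b'; c'] = [set z | adj ab z && adj ac z].
  by apply/eqP; rewrite eqEcard sub1 card1 [#|_|]c4.
have E2 : ac |: [set a'; b'; c'] = [set z | adj ab z && adj bc z].
  by apply/eqP; rewrite eqEcard sub2 card2 [#|_|]c4.
pose T := ac |: (bc |: [set a'; b'; c']).
have cardT : #|T| = 5 by rewrite cardsU1 card1 E1 inE adj_irr andbF.
have subT : T \subset [set z | adj ab z].
  apply/subsetP => z; rewrite in_setU1 => /orP[/eqP -> //|]; first by rewrite inE.
  by rewrite E1 !inE => /andP[].
have /subsetPn[s] : ~~ ([set z | adj ab z] \subset T).
  by apply/negP => /subset_leq_card; rewrite cardT [#|[set z | adj ab z]|]degree_adj.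
rewrite inE => abs sT.
have adjE z : adj ab z = (z \in s |: T).
  have /eqP -> : s |: T == [set z | adj ab z].
    rewrite eqEcard cardsU1 sT cardT [#|[set _ | _]|]degree_adj andbT.
    by rewrite subUset sub1set subT inE abs.
  by rewrite inE.
have nac : adj ac s = false.
  have /setP/(_ s) := E1; rewrite !inE abs /= => <-.
  by apply/negbTE; move: sT; apply: contra; rewrite !inE => ->; rewrite orbT.
have nbc : adj bc s = false.
  have /setP/(_ s) := E2; rewrite !inE abs /= => <-.
  by apply/negbTE; move: sT; apply: contra; rewrite !inE => /orP[] ->; rewrite ?orbT.
have le3 : common adj ab s <= #|[set a'; b'; c']|.
  apply/subset_leq_card/subsetP => z; rewrite inE adjE !in_setU1 => /andP[].
  case/or4P => [/eqP ->|/eqP ->|/eqP ->|//]; first by rewrite adj_irr.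
    by rewrite adj_sym nac.
  by rewrite adj_sym nbc.
case: (hexagon_far_neq h) => a'b' a'c' b'c'.
by move: le3; rewrite c4 // card_set3.
Qed.

End NonFlat.

(** One value 3 of [triples] lies on the diagonal by [triples3_diag], and a class function is
    constant there. *)
Lemma arc_triangle (x y : V) : diamond x y -> e y x.
Proof.
have [flat|/existsPn nf] := boolP [exists x, exists w, triples x w == 3]; last first.
  have nf2 u w : triples u w != 3 by have /existsPn/(_ w) := nf u.
  by case: (non_flat_absurd nf2 x).
case/existsP: flat => u /existsP[w /eqP uw].
have xx : triples x x = 3.
  by rewrite -uw -(triples3_diag uw); apply: class_fun_diag class_fun_triples.
have [a [b [c [ab [ac [bc [a' [b' [c' h]]]]]]]]] := hexagon_exists x.
have ud := out3_diamond h; move: xx; rewrite /triples (out3_count _ _ ud).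
case: ud => _ _ _ ->.
by case a1: (e ab x); case b1: (e ac x); case c1: (e bc x) => //= _ /or3P[] /eqP ->.
Qed.

Lemma arc_triangle4 (x y z w : V) :
  e x y -> e x z -> y != z -> e y w -> e z w -> e w x.
Proof.
move=> xy xz yz yw zw; have [c xc] := out3_third (degree_arc x) xy xz yz.
apply: arc_triangle; rewrite /diamond /paths2 (out3_count _ _ xc) yw zw.
by case cw: (e c w) => //; case: (arc_no3 xc yw zw cw).
Qed.

Lemma diamondE (x y : V) : diamond x y = e y x.
Proof.
have /eqP/setP/(_ y) : [set y | diamond x y] == [set y | e y x].
  rewrite eqEcard [#|[set y | diamond x y]|]degree_diamond (e_val x).2 andbT.
  by apply/subsetP => z; rewrite !inE; apply: arc_triangle.
by rewrite !inE.
Qed.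

(** * Straight walks *)

(** In the lattice [straight x (x + a)] is x + 2a and [apex (x + a) (x + b)] is x + a + b. *)
Definition straight (x y : V) : V := odflt y [pick z | e y z && ~~ e z x].

Definition apex (y z : V) : V := odflt y [pick w | e y w && e z w].

(** By [diamondE] exactly two of the three out-neighbours of y lead back to x; the third one
    continues the arc. *)
Lemma straight_ex (x y : V) : e x y ->
  exists2 z, e y z && ~~ e z x & forall w, e y w -> ~~ e w x -> w = z.
Proof.
move=> xy; have [a [b [c yabc]]] := out3_exists (degree_arc y).
have : diamond y x by rewrite diamondE.
rewrite /diamond /paths2 (out3_count _ _ yabc).
have [ya yb yc] := out3_rel yabc; case: yabc => _ _ _ yE.
case ax: (e a x); case bx: (e b x); case cx: (e c x) => // _.
- by exists c; rewrite ?yc ?cx // => w; rewrite yE => /or3P[] /eqP ->; rewrite ?ax ?bx.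
- by exists b; rewrite ?yb ?bx // => w; rewrite yE => /or3P[] /eqP ->; rewrite ?ax ?cx.
- by exists a; rewrite ?ya ?ax // => w; rewrite yE => /or3P[] /eqP ->; rewrite ?bx ?cx.
Qed.

Lemma straightP (x y : V) : e x y -> e y (straight x y) /\ ~~ e (straight x y) x.
Proof.
case/straight_ex => z zP _; rewrite /straight.
by case: pickP => [w /andP[]|/(_ z)]; rewrite ?zP.
Qed.

Lemma straight_uniq (x y z : V) : e x y -> e y z -> ~~ e z x -> straight x y = z.
Proof.
move=> xy yz zx; have [sy sx] := straightP xy; have [w _ wP] := straight_ex xy.
by rewrite (wP _ sy sx) (wP _ yz zx).
Qed.

Lemma apex_uniq (y z w : V) : y != z -> e y w -> e z w -> apex y z = w.
Proof.
move=> yz yw zw; rewrite /apex; case: pickP => [t /andP[yt zt]|/(_ w)].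
  exact: arc_lin yz.
by rewrite yw zw.
Qed.

Section Corner.
Variables x a b : V.
Hypotheses (xa : e x a) (xb : e x b) (ab : a != b).

Lemma apexP : e a (apex a b) /\ e b (apex a b).
Proof. by have [w aw bw] := arc_co xa xb; rewrite (apex_uniq ab aw bw). Qed.

Lemma apexC : apex a b = apex b a.
Proof. by have [am bm] := apexP; rewrite [RHS](@apex_uniq _ _ (apex a b)) // eq_sym. Qed.

Lemma apex_back : e (apex a b) x.
Proof. by have [am bm] := apexP; apply: arc_triangle4 am bm. Qed.

Lemma straight_neq_apex : apex a b != straight x a.
Proof.
have [_ sx] := straightP xa.
by apply: contraNneq sx => <-; apply: apex_back.
Qed.

(* The local flatness of the triangulation: going round the vertex [apex a b]
   from either side leads to the same continuation. *)
Lemma apex_straight : apex (apex a b) (straight x a) = straight b (apex a b)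
  /\ e (straight b (apex a b)) a.
Proof.
have [am bm] := apexP; have [as_ sx] := straightP xa.
have [z mz sz] := arc_co am as_.
have za : e z a := arc_triangle4 am as_ straight_neq_apex mz sz.
have zb : ~~ e z b.
  apply/negP => zb; suff zx : z = x by rewrite zx (negPf sx) in sz.
  apply/eqP/negPn/negP => zx; move: ab; rewrite (arc_lin za xa zb xb zx).
  by rewrite eqxx.
by rewrite (apex_uniq straight_neq_apex mz sz) (straight_uniq bm mz zb).
Qed.

End Corner.

Lemma apex_neq (x a b c : V) : out3 e x a b c -> apex a b != apex a c.
Proof.
move=> xabc; have [xa xb xc] := out3_rel xabc; have [ab ac _ _] := xabc.
have [a1 b1] := apexP xa xb ab; have [a2 c2] := apexP xa xc ac.
by apply/eqP => E; rewrite -E in c2; apply: arc_no3 xabc a1 b1 c2.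
Qed.

(** The arc from [apex a b] to x has the direction c because a + b + c = 0. *)
Lemma straight_back (x a b c : V) : out3 e x a b c -> straight (apex a b) x = c.
Proof.
move=> xabc; have [xa xb xc] := out3_rel xabc; have [ab _ _ _] := xabc.
have [am bm] := apexP xa xb ab.
apply: straight_uniq xc _; first exact: apex_back xa xb ab.
by apply/negP => cm; apply: arc_no3 xabc am bm cm.
Qed.

Lemma out3_straight (x a b c : V) :
  out3 e x a b c -> out3 e a (apex a b) (apex a c) (straight x a).
Proof.
move=> xabc; have [xa xb xc] := out3_rel xabc; have [ab ac _ _] := xabc.
apply: out3_complete (degree_arc a) _ _ _ _ _ _.
- by case: (apexP xa xb ab).
- by case: (apexP xa xc ac).
- by case: (straightP xa).
- exact: apex_neq xabc.
- exact: straight_neq_apex xb ab.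
- exact: straight_neq_apex xc ac.
Qed.

Lemma hexagon_straight (x a b c : V) : out3 e x a b c ->
  hexagon x a b c (apex a b) (apex a c) (apex b c)
    (straight x a) (straight x b) (straight x c).
Proof.
move=> xabc; have [xa xb xc] := out3_rel xabc; have [ab ac bc _] := xabc.
split=> //; first exact: out3_straight xabc.
  by rewrite (apexC xa xb ab); apply: out3_straight (out3_swap xabc).
rewrite (apexC xa xc ac) (apexC xb xc bc).
exact: out3_straight (out3_rot (out3_rot xabc)).
Qed.

Lemma out3_apex (x a b c : V) : out3 e x a b c ->
  out3 e (apex a b) (straight a (apex a b)) (straight b (apex a b)) x.
Proof.
move=> xabc; have [xa xb _] := out3_rel xabc; have [ab _ _ _] := xabc.
have [am bm] := apexP xa xb ab.
have [s1 s1a] := straightP am; have [s2 s2b] := straightP bm.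
have [_ s2a] := apex_straight xa xb ab.
apply: out3_complete (degree_arc _) s1 s2 (apex_back xa xb ab) _ _ _.
- by apply: contraNneq s1a => ->.
- by apply: contraNneq s1a => ->.
- by apply: contraNneq s2b => ->.
Qed.

Fixpoint walk (m : nat) (x y : V) : V :=
  if m is m'.+1 then walk m' y (straight x y) else x.

(** The power sum p_m of the three directions; p_0 is three times the identity. *)
Definition walks (m : nat) (x y : V) : nat := \sum_z e x z * (walk m x z == y).

Lemma out3_sum (r : rel V) (x a b c : V) (G : V -> nat) :
  out3 r x a b c -> \sum_z r x z * G z = G a + G b + G c.
Proof.
case=> ab ac bc rE; rewrite (eq_bigr (fun z => if z \in a |: (b |: [set c]) then G z else 0)).
  by rewrite -big_mkcond big_setU1 ?big_setU1 ?big_set1 ?inE ?(negPf ab) //= addnA.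
by move=> z _; rewrite rE !inE; case: ifP => _; rewrite ?mul1n.
Qed.

(* Newton's identity p_(m+3) + e_2 p_(m+1) = e_1 p_(m+2) + e_3 p_m for the power
   sums of three commuting shifts with product 1, read off the hexagon around x. *)
Lemma walks_rec (m : nat) (x y : V) :
  walks m.+3 x y + conv (fun x y => e y x) (walks m.+1) x y =
  conv (fun x y => e x y) (walks m.+2) x y + walks m x y.
Proof.
have [a [b [c xabc]]] := out3_exists (degree_arc x).
have hx := hexagon_straight xabc; have [_ aa bb cc] := hx.
have xin : out3 (fun x y => e y x) x (apex a b) (apex a c) (apex b c).
  by case: (out3_diamond hx) => d1 d2 d3 dE; split=> // z; rewrite -diamondE.
have xacb : out3 e x a c b := out3_swap (out3_rot (out3_rot xabc)).
have xbca := out3_rot xabc.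
rewrite /conv (out3_sum _ xabc) (out3_sum _ xin).
rewrite /walks (out3_sum _ aa) (out3_sum _ bb) (out3_sum _ cc) !(out3_sum _ xabc).
rewrite (out3_sum _ (out3_apex xabc)) (out3_sum _ (out3_apex xacb)).
rewrite (out3_sum _ (out3_apex xbca)) /=.
rewrite (straight_back xabc) (straight_back xacb) (straight_back xbca).
do 3!move: (nat_of_bool (walk _ x _ == y)) => ?.
do 9!move: (nat_of_bool (walk _ _ _ == y)) => ?.
by clear; lia.
Qed.

Lemma class_fun_walks (m : nat) : class_fun (walks m).
Proof.
have ce := class_fun_nat class_fun_arc; have ce' := class_fun_tr ce.
suff : class_fun (walks m) /\ class_fun (walks m.+1) /\ class_fun (walks m.+2).
  by case.
elim: m => [|m [cm [cm1 cm2]]]; last do 2!split=> //.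
  have c1 : class_fun (walks 1).
    apply: class_fun_ext ce => x y; rewrite /walks (bigD1 y) //= eqxx muln1 big1 ?addn0 //.
    by move=> z /negPf ->; rewrite muln0.
  split; [|split=> //].
    apply: class_fun_ext (class_fun_comp (fun b : bool => 3 * b) class_fun_eq) => x y.
    by rewrite /walks /= -big_distrl /= -degree_sum degree_arc.
  (* This is p_2 = e_1^2 - 2 e_2, with [paths2] for e_1^2 and [diamond] for e_2. *)
  apply: class_fun_ext (class_fun_comp2 (fun p d => p - 2 * nat_of_bool d)
    class_fun_paths2 class_fun_diamond) => x y.
  have [a [b [c xabc]]] := out3_exists (degree_arc x).
  have hx := hexagon_straight xabc; have [_ aa bb cc] := hx.
  rewrite /walks (out3_sum _ xabc) /paths2 (out3_count _ _ xabc) /=.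
  have one (r : rel V) u v w t : out3 r u v w t ->
      (r u y : nat) = (y == v) + (y == w) + (y == t).
    case=> vw vt wt ->; case: (y =P v) => [->|_]; first by rewrite (negPf vw) (negPf vt).
    by case: (y =P w) => [->|_] //; rewrite (negPf wt).
  rewrite (one _ _ _ _ _ aa) (one _ _ _ _ _ bb) (one _ _ _ _ _ cc).
  rewrite (one _ _ _ _ _ (out3_diamond hx)) ![straight _ _ == y]eq_sym.
  by clear; do 6!move: (nat_of_bool (y == _)) => ?; lia.
apply: class_fun_ext (class_fun_comp2 subn (class_fun_comp2 addn
  (class_fun_conv ce cm2) cm) (class_fun_conv ce' cm1)) => x y.
by rewrite -walks_rec addnK.
Qed.

Lemma walks_gt0P (m : nat) (x y : V) :
  reflect (exists2 z, e x z & walk m x z = y) (0 < walks m x y).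
Proof.
apply: (iffP idP) => [|[z xz <-]]; last by rewrite /walks (bigD1 z) //= xz eqxx.
have [z /andP[xz /eqP <-] _|no] := pickP (fun z => e x z && (walk m x z == y)).
  by exists z.
by rewrite /walks big1 // => z _; rewrite mulnb no.
Qed.

(** If one straight m-walk closes, then one closes at every vertex. The ends of those that do not
    close form an irreflexive class relation of valency at most two, which is empty. *)
Lemma walk_closed (m : nat) (x : V) :
  0 < walks m x x -> forall u v, e u v -> walk m u v = u.
Proof.
move=> mx u v uv; have cw := class_fun_walks m.
have mu w : 0 < walks m w w by rewrite (class_fun_diag w x cw).
pose r w z := (w != z) && (0 < walks m w z).
have cr : class_fun r.
  exact: (class_fun_comp2 (fun a n => ~~ a && (0 < n)) class_fun_eq cw).
have r2 w : degree r w <= 2.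
  have : \sum_z walks m w z = 3.
    rewrite exchange_big (eq_bigr (fun z => e w z : nat)) => [|z _].
      by rewrite -degree_sum degree_arc.
    rewrite (bigD1 (walk m w z)) //= eqxx muln1 big1 ?addn0 // => t.
    by rewrite eq_sym => /negPf ->; rewrite muln0.
  rewrite (bigD1 w) //= => sum3.
  have : degree r w <= \sum_(z | z != w) walks m w z.
    rewrite degree_sum (bigD1 w) //= {1}/r eqxx add0n; apply: leq_sum => z zw.
    by rewrite /r eq_sym zw /=; case: (walks m w z).
  by have := mu w; move: sum3; clear; lia.
have ir : irreflexive r by move=> w; rewrite /r eqxx.
have := degree_le2_empty u (walk m u v) cr ir r2; rewrite /r.
case: eqP => //= _ /negP[]; apply/walks_gt0P; by exists v.
Qed.

(** * Frames and shifts *)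

(* A frame names the three directions at a single vertex; [shift i] transports it
   along the direction i. That these names are globally consistent is
   [shift_holonomy]. *)
Definition frame_ok (f : V * {ffun 'I_3 -> V}) : bool :=
  [forall i, e f.1 (f.2 i)] && injectiveb f.2.

Definition frame : Type := {f : V * {ffun 'I_3 -> V} | frame_ok f}.

HB.instance Definition _ := Finite.on frame.

Definition base (f : frame) : V := (val f).1.

Definition dir (f : frame) (i : 'I_3) : V := (val f).2 i.

Lemma dir_arc (f : frame) (i : 'I_3) : e (base f) (dir f i).
Proof. by have /andP[/forallP/(_ i)] := valP f. Qed.

Lemma dir_inj (f : frame) : injective (dir f).
Proof. by have /andP[_ /injectiveP] := valP f. Qed.

Lemma frame_eq (f g : frame) : base f = base g -> dir f =1 dir g -> f = g.
Proof.
case: f g => [[x a] fP] [[y b] gP] /= xy ab; apply: val_inj => /=.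
by rewrite [x]xy; congr (_, _); apply/ffunP => i; apply: ab.
Qed.

Lemma frame_exists (x : V) (a : 'I_3 -> V) :
  (forall i, e x (a i)) -> injective a -> {f : frame | base f = x & dir f =1 a}.
Proof.
move=> xa ia; have fP : frame_ok (x, finfun a).
  apply/andP; split=> /=; first by apply/forallP => i; rewrite ffunE.
  by apply/injectiveP => i j; rewrite !ffunE => /ia.
by exists (exist _ (x, finfun a) fP) => // i; rewrite /dir /= ffunE.
Qed.

Lemma ord3_third (i j : 'I_3) : i != j ->
  exists k, [/\ i != k, j != k & forall l, [|| l == i, l == j | l == k]].
Proof.
have /forallP/(_ i)/forallP/(_ j) : [forall i : 'I_3, forall j : 'I_3, (i != j) ==>
  [exists k, [&& i != k, j != k & [forall l, [|| l == i, l == j | l == k]]]]].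
  apply/forallP => -[[|[|[|//]]] ?]; apply/forallP => -[[|[|[|//]]] ?];
    rewrite -val_eqE //=; apply/existsP;
    [ exists (@Ordinal 3 2 isT) | exists (@Ordinal 3 1 isT) | exists (@Ordinal 3 2 isT)
    | exists (@Ordinal 3 0 isT) | exists (@Ordinal 3 1 isT) | exists (@Ordinal 3 0 isT)];
    rewrite -!val_eqE /=; by apply/forallP => -[[|[|[|//]]] ?]; rewrite -!val_eqE.
move=> /implyP H /H /existsP[k /and3P[ik jk /forallP kP]]; by exists k.
Qed.

Lemma dir_out3 (f : frame) (i j k : 'I_3) : i != j -> i != k -> j != k ->
  out3 e (base f) (dir f i) (dir f j) (dir f k).
Proof.
by move=> ij ik jk; apply: out3_complete; rewrite ?degree_arc ?dir_arc // (inj_eq (@dir_inj f)).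
Qed.

Lemma dir_onto (f : frame) (y : V) : e (base f) y -> exists i, y = dir f i.
Proof.
have [_ _ _ fE] := @dir_out3 f 0%R 1%R 2%R isT isT isT.
by rewrite fE => /or3P[] /eqP ->; [exists 0%R | exists 1%R | exists 2%R].
Qed.

(** Parallel transport: the direction i goes straight on, and any other direction j becomes the
    opposite side of the rhombus spanned by i and j. *)
Definition step_dir (f : frame) (i j : 'I_3) : V :=
  if j == i then straight (base f) (dir f i) else apex (dir f i) (dir f j).

Lemma step_dir_arc (f : frame) (i j : 'I_3) : e (dir f i) (step_dir f i j).
Proof.
rewrite /step_dir; case: eqVneq => [_|ji]; first by case: (straightP (dir_arc f i)).
have ij : dir f i != dir f j by rewrite (inj_eq (@dir_inj f)) eq_sym.
by case: (apexP (dir_arc f i) (dir_arc f j) ij).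
Qed.

Lemma step_dir_inj (f : frame) (i : 'I_3) : injective (step_dir f i).
Proof.
have neq j : j != i -> apex (dir f i) (dir f j) != straight (base f) (dir f i).
  move=> ji; have ij : dir f i != dir f j by rewrite (inj_eq (@dir_inj f)) eq_sym.
  exact: straight_neq_apex (dir_arc f i) (dir_arc f j) ij.
move=> j k; rewrite /step_dir.
case: (eqVneq j i) (eqVneq k i) => [->|ji] [->|ki] //.
- by move=> /esym /eqP; rewrite (negPf (neq k ki)).
- by move=> /eqP; rewrite (negPf (neq j ji)).
apply: contra_eq => jk; apply: apex_neq.
by apply: dir_out3; rewrite // eq_sym.
Qed.

Definition step (i : 'I_3) (f : frame) : frame :=
  s2val (frame_exists (step_dir_arc f i) (@step_dir_inj f i)).

Lemma base_step (i : 'I_3) (f : frame) : base (step i f) = dir f i.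
Proof. exact: (s2valP (frame_exists (step_dir_arc f i) (@step_dir_inj f i))). Qed.

Lemma dir_step (i : 'I_3) (f : frame) (j : 'I_3) : dir (step i f) j = step_dir f i j.
Proof. exact: (s2valP' (frame_exists (step_dir_arc f i) (@step_dir_inj f i))). Qed.

Lemma dir_step_same (i : 'I_3) (f : frame) :
  dir (step i f) i = straight (base f) (dir f i).
Proof. by rewrite dir_step /step_dir eqxx. Qed.

Lemma dir_step_other (i j : 'I_3) (f : frame) :
  i != j -> dir (step i f) j = apex (dir f i) (dir f j).
Proof. by rewrite dir_step /step_dir eq_sym => /negPf ->. Qed.

Lemma dir_step2 (i j k : 'I_3) (f : frame) : i != j -> i != k -> j != k ->
  [/\ dir (step j (step i f)) i = straight (dir f j) (apex (dir f i) (dir f j)),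
      dir (step j (step i f)) j = straight (dir f i) (apex (dir f i) (dir f j))
    & dir (step j (step i f)) k = base f].
Proof.
move=> ij ik jk; have ji : j != i by rewrite eq_sym.
have [dij dik _ _] := dir_out3 f ij ik jk.
have [fi fj fk] := And3 (dir_arc f i) (dir_arc f j) (dir_arc f k).
rewrite dir_step_same !(dir_step_other _ ji) !(dir_step_other _ jk) base_step.
rewrite dir_step_same !(dir_step_other _ ij) !(dir_step_other _ ik); split=> //.
  by case: (apex_straight fi fj dij).
apply: apex_uniq (apex_back fi fj dij) (apex_back fi fk dik).
exact: apex_neq (dir_out3 f ij ik jk).
Qed.

Lemma step_comm (i j : 'I_3) (f : frame) : step j (step i f) = step i (step j f).
Proof.
have [->//|ij] := eqVneq i j; have ji : j != i by rewrite eq_sym.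
have [k [ik jk kP]] := ord3_third ij.
have dij : dir f i != dir f j by rewrite (inj_eq (@dir_inj f)).
have mC := apexC (dir_arc f i) (dir_arc f j) dij.
have [e1 e2 e3] := dir_step2 f ij ik jk; have [e1' e2' e3'] := dir_step2 f ji jk ik.
apply: frame_eq; first by rewrite !base_step !dir_step_other.
by move=> l; case/or3P: (kP l) => /eqP ->; rewrite ?e1 ?e2 ?e3 ?e1' ?e2' ?e3' -?mC.
Qed.

(** This is a + b + c = 0 at the level of frames, and it supplies the inverse of each [step]. *)
Lemma step_loop (i j k : 'I_3) (f : frame) : i != j -> i != k -> j != k ->
  step k (step j (step i f)) = f.
Proof.
move=> ij ik jk; have fout := dir_out3 f ij ik jk.
have [dij _ _ _] := fout; have [fi fj fk] := out3_rel fout.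
have [am bm] := apexP fi fj dij.
have [e1 e2 e3] := dir_step2 f ij ik jk.
have ki : k != i by rewrite eq_sym.
have kj : k != j by rewrite eq_sym.
have dji : dir f j != dir f i by rewrite eq_sym.
have mC := apexC fi fj dij.
have [_ sa] := apex_straight fi fj dij; have [_ sb] := apex_straight fj fi dji.
have [_ nsb] := straightP bm; have [_ nsa] := straightP am.
have [t [_ _ tP]] := ord3_third ij.
have tk : t = k.
  by case/or3P: (tP k) => /eqP //; [move/eqP; rewrite (negPf ki)|move/eqP; rewrite (negPf kj)].
apply: frame_eq; first by rewrite base_step e3.
move=> l; case/or3P: (tP l) => /eqP ->.
- rewrite dir_step_other // e3 e1; apply: apex_uniq => //.
  by apply: contraNneq nsb => <-.
- rewrite dir_step_other // e3 e2; apply: apex_uniq => //; last by rewrite mC.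
  by apply: contraNneq nsa => <-.
rewrite tk dir_step_same e3 base_step dir_step_other //.
exact: straight_back fout.
Qed.

Lemma step_inj (i : 'I_3) : injective (step i).
Proof.
have [j ij] : exists j, i != j.
  by case: (eqVneq i 0%R) => [->|]; [exists 1%R | exists 0%R].
have [k [ik jk _]] := ord3_third ij.
by move=> f g fg; rewrite -(step_loop f ij ik jk) fg step_loop.
Qed.

Definition shift (i : 'I_3) : {perm frame} := perm (@step_inj i).

Lemma shiftE (i : 'I_3) (f : frame) : shift i f = step i f.
Proof. by rewrite permE. Qed.

Lemma shift_comm (i j : 'I_3) : commute (shift i) (shift j).
Proof. by apply/permP => f; rewrite !permM !shiftE step_comm. Qed.

Lemma shiftX_comm (i j : 'I_3) (m n : nat) :
  commute (shift i ^+ m)%g (shift j ^+ n)%g.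
Proof. exact/commuteX2/shift_comm. Qed.

Lemma shift_loop (i j k : 'I_3) : i != j -> i != k -> j != k ->
  (shift i * shift j * shift k = 1)%g.
Proof.
by move=> ij ik jk; apply/permP => f; rewrite !permM !shiftE perm1 step_loop.
Qed.

Lemma base_shiftX (i : 'I_3) (m : nat) (f : frame) :
  base ((shift i ^+ m)%g f) = walk m (base f) (dir f i).
Proof.
rewrite permX; elim: m f => // m IHm f.
by rewrite iterSr IHm shiftE base_step dir_step_same.
Qed.

(** By [walk_closed] the m-th power of every shift fixes all bases. It commutes with the shifts, so
    it fixes the bases of the neighbouring frames too, and these are the directions. *)
Lemma shiftX_closed (i j : 'I_3) (m : nat) (f : frame) :
  base ((shift i ^+ m)%g f) = base f -> (shift j ^+ m = 1)%g.
Proof.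
rewrite base_shiftX => mf; have cl : forall u v, e u v -> walk m u v = u.
  apply: (@walk_closed m (base f)); apply/walks_gt0P.
  by exists (dir f i) => //; apply: dir_arc.
have fix_base l g : base ((shift l ^+ m)%g g) = base g.
  by rewrite base_shiftX cl // dir_arc.
apply/permP => g; rewrite perm1; apply: frame_eq; first exact: fix_base.
move=> k; rewrite -!base_step -!shiftE -!permM.
by rewrite -(commuteX m (shift_comm k j)) permM fix_base.
Qed.

Definition relabel_ffun (p : {perm 'I_3}) (f : frame) : {f' : frame |
  base f' = base f & dir f' =1 dir f \o p}.
Proof.
by apply: frame_exists => [i|]; [apply: dir_arc | apply/inj_comp/perm_inj/dir_inj].
Qed.

Definition relabel (p : {perm 'I_3}) (f : frame) : frame := s2val (relabel_ffun p f).

Lemma base_relabel (p : {perm 'I_3}) (f : frame) : base (relabel p f) = base f.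
Proof. exact: (s2valP (relabel_ffun p f)). Qed.

Lemma dir_relabel (p : {perm 'I_3}) (f : frame) (i : 'I_3) :
  dir (relabel p f) i = dir f (p i).
Proof. exact: (s2valP' (relabel_ffun p f)). Qed.

Lemma relabel_ex (f g : frame) : base f = base g -> exists p, g = relabel p f.
Proof.
move=> fg; have /fin_all_exists[q qP] : forall i, exists j, dir g i = dir f j.
  by move=> i; apply: dir_onto; rewrite fg dir_arc.
have qi : injective q by move=> i j E; apply: (@dir_inj g); rewrite !qP E.
exists (perm qi); apply: frame_eq; first by rewrite base_relabel.
by move=> i; rewrite dir_relabel permE.
Qed.

Lemma shift_relabel (i : 'I_3) (p : {perm 'I_3}) (f : frame) :
  shift i (relabel p f) = relabel p (shift (p i) f).
Proof.
apply: frame_eq; first by rewrite base_relabel !shiftE !base_step dir_relabel.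
move=> j; rewrite dir_relabel !shiftE !dir_step /step_dir base_relabel !dir_relabel.
by rewrite (inj_eq perm_inj).
Qed.

Lemma shiftX_relabel (i : 'I_3) (p : {perm 'I_3}) (m : nat) (f : frame) :
  (shift i ^+ m)%g (relabel p f) = relabel p ((shift (p i) ^+ m)%g f).
Proof. by rewrite !permX; elim: m => //= m ->; rewrite shift_relabel. Qed.

Lemma shift_generated (i j k : 'I_3) (n : nat) : i != j ->
  exists n1 n2, (shift k ^+ n = shift i ^+ n1 * shift j ^+ n2)%g.
Proof.
move=> ij; have [l [il jl lP]] := ord3_third ij.
case/or3P: (lP k) => /eqP ->.
- by exists n, 0; rewrite expg0 mulg1.
- by exists 0, n; rewrite expg0 mul1g.
(* The third shift is the inverse of the product of the other two; inverses are written as powers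
   with exponent the order minus one. *)
exists (#[shift i]%g.-1 * n), (#[shift j]%g.-1 * n); rewrite !expgM -!invg_expg.
rewrite -expgMn; last first.
  by apply: commuteV; apply: commute_sym; apply: commuteV; apply: shift_comm.
congr (_ ^+ _)%g; rewrite -invMg -(shift_comm i j).
by apply/eqP; rewrite eq_sym eq_invg_mul shift_loop.
Qed.

(* If a shift by s^n1 t^n2 fixes the vertex of f but relabels its frame by p with
   p s = t, then going back n1 steps along t turns it into a pure power of the
   shift along t, which fixes no vertex unless it is trivial. *)
Lemma shift_holonomy (i j : 'I_3) (m n : nat) (f : frame) : i != j ->
  base ((shift i ^+ m * shift j ^+ n)%g f) = base f ->
  (shift i ^+ m * shift j ^+ n)%g f = f.
Proof.
move=> ij /esym /relabel_ex[p fp]; rewrite fp.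
have [->|] := eqVneq p 1%g.
  by apply: frame_eq => [|k]; rewrite ?base_relabel ?dir_relabel ?perm1.
move=> p1; have [s ps] : exists s, s != p s.
  apply/existsP; apply: contraNT p1 => /existsPn pE; apply/eqP/permP => s.
  by have /negbNE/eqP <- := pE s; rewrite perm1.
have [m' [n' E]] : exists m' n',
    (shift i ^+ m * shift j ^+ n = shift s ^+ m' * shift (p s) ^+ n')%g.
  have [m1 [m2 ->]] := shift_generated i m ps.
  have [n1 [n2 ->]] := shift_generated j n ps.
  exists (m1 + n1), (m2 + n2); rewrite !expgD -!mulgA; congr (_ * _)%g.
  by rewrite !mulgA; congr (_ * _)%g; apply: shiftX_comm.
pose g := (shift (p s) ^+ m')^-1%g f.
have gf : (shift (p s) ^+ m')%g g = f by rewrite -permM mulVg perm1.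
(* Relabelling by p turns steps along s into steps along [p s], so m' steps along s take both sides
   to [relabel p f]. *)
have gp : (shift (p s) ^+ (m' + n'))%g g = relabel p g.
  apply: (@perm_inj _ (shift s ^+ m')%g); rewrite shiftX_relabel gf.
  by rewrite expgD permM gf -permM -shiftX_comm -E -fp.
have cl : base ((shift (p s) ^+ (m' + n'))%g g) = base g by rewrite gp base_relabel.
move: gp; rewrite (shiftX_closed (p s) cl) perm1 => gp.
by move: ps; rewrite -(inj_eq (@dir_inj g)) -dir_relabel -gp eqxx.
Qed.

(** * Coordinates *)

Lemma frame_ex (x : V) : exists f : frame, base f = x.
Proof.
have [a [b [c xabc]]] := out3_exists (degree_arc x).
have [xa xb xc] := out3_rel xabc; have [ab ac bc _] := xabc.
have [||f fx _] := @frame_exists x (tnth [tuple a; b; c]).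
- by case=> -[|[|[|]]].
- move=> i j; have /tuple_uniqP : uniq [tuple a; b; c]; last by apply.
  by rewrite /= !inE negb_or ab ac bc.
by exists f.
Qed.

Section Coordinates.
Variable f0 : frame.

Variable N : nat.
Hypothesis NE : N = #[shift 0%R]%g.

Lemma shift_order (i : 'I_3) (m : nat) (f : frame) :
  base ((shift i ^+ m)%g f) = base f -> N %| m.
Proof. by move=> /shiftX_closed-/(_ 0%R) E; rewrite NE order_dvdn E. Qed.

Lemma shiftX_order (i : 'I_3) : (shift i ^+ N = 1)%g.
Proof. by apply: (@shiftX_closed 0%R _ _ f0); rewrite NE expg_order perm1. Qed.

Lemma shiftX_mod (i : 'I_3) (m n : nat) :
  m = n %[mod N] -> (shift i ^+ m = shift i ^+ n)%g.
Proof.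
by move=> mn; rewrite -(expg_mod m (shiftX_order i)) mn expg_mod // shiftX_order.
Qed.

Definition word (i j : nat) : {perm frame} := (shift 0%R ^+ i * shift 1%R ^+ j)%g.

Definition pos (i j : nat) : V := base (word i j f0).

Lemma wordD (i j i' j' : nat) : (word i j * word i' j')%g = word (i + i') (j + j').
Proof.
rewrite /word !expgD -!mulgA; congr (_ * _)%g; rewrite !mulgA; congr (_ * _)%g.
exact: shiftX_comm.
Qed.

Lemma word_mod (i j i' j' : nat) :
  i = i' %[mod N] -> j = j' %[mod N] -> word i j = word i' j'.
Proof. by move=> ii jj; rewrite /word (shiftX_mod _ ii) (shiftX_mod _ jj). Qed.

Lemma word00 : word 0 0 = 1%g.
Proof. by rewrite /word !expg0 mulg1. Qed.

Lemma order_gt0N : 0 < N.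
Proof. by rewrite NE order_gt0. Qed.

Lemma wordX (i j m : nat) : (word i j ^+ m)%g = word (i * m) (j * m).
Proof. by elim: m => [|m IHm]; rewrite ?muln0 ?word00 // expgS IHm wordD !mulnS. Qed.

Lemma pos_eq (i j i' j' : nat) : pos i j = pos i' j' -> word i j f0 = word i' j' f0.
Proof.
(* Exponents are natural numbers, so [N.-1 * i'] stands for - i' modulo N. *)
pose a := N.-1 * i' + i; pose b := N.-1 * j' + j.
have E : word i j = (word i' j' * word a b)%g.
  rewrite wordD; apply: word_mod; rewrite /a /b addnA -mulSn prednK ?order_gt0N //;
  by rewrite mulnC modnMDl.
by rewrite /pos E permM; apply: shift_holonomy.
Qed.

Lemma shift_word (k : 'I_3) : exists i j, shift k = word i j.
Proof.
have [i [j E]] := @shift_generated 0%R 1%R k 1 isT.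
by exists i, j; rewrite /word -E expg1.
Qed.

Lemma pos_onto (y : V) : exists i j, y = pos i j.
Proof.
have /connectP[p] := e_wdr.1 (base f0) y.
elim/last_ind: p y => [|p z IHp] y.
  by move=> _ ->; exists 0, 0; rewrite /pos word00 perm1.
rewrite rcons_path last_rcons => /andP[pp lz] ->.
have [i [j E]] := IHp _ pp erefl; rewrite E in lz.
have [k ->] := dir_onto lz; rewrite -base_step -shiftE.
by have [i' [j' ->]] := shift_word k; exists (i + i'), (j + j'); rewrite -permM wordD.
Qed.

Lemma walks_pos (m i j : nat) (y : V) :
  reflect (exists k, y = base ((shift k ^+ m)%g (word i j f0))) (0 < walks m (pos i j) y).
Proof.
apply: (iffP (walks_gt0P _ _ _)) => [[z /dir_onto[k ->] <-]|[k ->]].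
  by exists k; rewrite base_shiftX.
by exists (dir (word i j f0) k); [apply: dir_arc | rewrite base_shiftX].
Qed.

Lemma arc_pos (i j : nat) (y : V) :
  reflect (exists k, y = base (shift k (word i j f0))) (e (pos i j) y).
Proof.
apply: (iffP idP) => [/dir_onto[k ->]|[k ->]].
  by exists k; rewrite shiftE base_step.
by rewrite shiftE base_step dir_arc.
Qed.

Lemma order_gt1N : 1 < N.
Proof.
rewrite ltn_neqAle order_gt0N andbT eq_sym; apply/eqP => N1.
have := shiftX_order 0%R; rewrite N1 expg1 => E.
have := dir_arc f0 0%R; rewrite -base_step -shiftE E perm1.
by rewrite e_irr.
Qed.

(** For a prime divisor q of N other than N, straight q-walks form a nonempty irreflexive class
    relation, so by primitivity every vertex is reached by q-th powers of words, in particular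
    [pos 1 0]. Raising this relation to the power N / q shows that N divides N / q. *)
Lemma order_prime : prime N.
Proof.
have qN := pdiv_dvd N; have pq := pdiv_prime order_gt1N; set q := pdiv N in qN pq.
have [<-//|qnN] := eqVneq q N.
have Nq : ~~ (N %| q).
  by apply: contra qnN => Nq; rewrite eqn_dvd qN.
have cw : class_fun (fun x y => 0 < walks q x y).
  by apply: class_fun_comp (fun n => 0 < n) _ (class_fun_walks q).
have irr x : (0 < walks q x x) = false.
  apply: contraNF Nq => /walks_gt0P[z xz wz]; have [f fx] := frame_ex x.
  have [k kz] : exists k, z = dir f k by apply: dir_onto; rewrite fx.
  by apply: (@shift_order k _ f); rewrite base_shiftX fx -kz.
have [y xy] : exists y, 0 < walks q (pos 0 0) y.
  by exists (base ((shift 0%R ^+ q)%g (word 0 0 f0))); apply/walks_pos; exists 0%R.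
have nxy : pos 0 0 != y by apply: contraTneq xy => <-; rewrite irr.
have /connectP[p] := class_fun_connect (pos 0 0) (pos 1 0) cw nxy xy.
move=> pp lp; have [i [j E]] : exists i j, pos 1 0 = pos (i * q) (j * q).
  move: pp lp; elim/last_ind: p (pos 1 0) => [|p z IHp] u.
    by move=> _ ->; exists 0, 0.
  rewrite rcons_path last_rcons => /andP[pp lz] ->.
  have [i [j E]] := IHp _ pp erefl; rewrite E in lz.
  have /walks_pos[k ->] := lz; have [i' [j' ->]] := shift_word k.
  by exists (i + i'), (j + j'); rewrite wordX -permM wordD !mulnDl.
have fixq : word (1 + N.-1 * (i * q)) (N.-1 * (j * q)) f0 = f0.
  have := congr1 (word (N.-1 * (i * q)) (N.-1 * (j * q))) (pos_eq E).
  rewrite -!permM !wordD -!mulSn prednK ?order_gt0N // add0n.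
  rewrite [word (N * _) _](_ : _ = 1%g) ?perm1 // -word00.
  by apply: word_mod; rewrite mod0n modnMr.
have Nd : N %/ q * q = N by apply: divnK.
have fixN : word (N %/ q) 0 f0 = f0.
  have : (word (1 + N.-1 * (i * q)) (N.-1 * (j * q)) ^+ (N %/ q))%g f0 = f0.
    by rewrite permX; elim: (N %/ q) => //= n ->.
  rewrite wordX (_ : word _ _ = word (N %/ q) 0) //.
  apply: word_mod; last by rewrite -!mulnA [q * _]mulnC Nd mulnA modnMl mod0n.
  by rewrite mulnDl mul1n -!mulnA [q * _]mulnC Nd mulnA addnC modnMDl.
have : N %| N %/ q.
  apply: (@shift_order 0%R _ f0); rewrite -{2}fixN /word expg0 mulg1 //.
move/dvdn_leq; rewrite divn_gt0 ?prime_gt0 // (dvdn_leq order_gt0N qN) => /(_ isT).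
by rewrite leqNgt ltn_Pdiv ?prime_gt1 ?order_gt0N.
Qed.


Lemma iso_of_bij (W : finType) (e' : rel W) (psi : W -> V) :
  injective psi -> (forall y, exists u, y = psi u) ->
  (forall u v, e (psi u) (psi v) = e' u v) -> digraph_iso e e'.
Proof.
move=> psi_inj /fin_all_exists[phi phiK] psiE.
have psiK : cancel psi phi by move=> u; apply: psi_inj; rewrite -phiK.
exists phi; first by exists psi => [y|]; rewrite -?phiK.
by move=> x y; rewrite -psiE -!phiK.
Qed.

Lemma shift2_word : shift 2%R = word N.-1 N.-1.
Proof.
have := @shift_loop 0%R 1%R 2%R isT isT isT => /eqP.
rewrite -[X in (X * _)%g](_ : word 1 1 = _); last by rewrite /word !expg1.
rewrite -eq_invg_mul => /eqP <-; apply/eqP; rewrite eq_invg_mul wordD.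
rewrite !add1n prednK ?order_gt0N //.
by apply/eqP; rewrite -word00; apply: word_mod; rewrite modnn mod0n.
Qed.

Lemma ord3_cases (k : 'I_3) : [\/ k = 0%R, k = 1%R | k = 2%R].
Proof.
by case: k => -[|[|[|//]]] ?; [constructor 1 | constructor 2 | constructor 3];
   apply: val_inj.
Qed.

Lemma arc_posE (i j : nat) (y : V) :
  e (pos i j) y = [|| y == pos (i + 1) j, y == pos i (j + 1)
                    | y == pos (i + N.-1) (j + N.-1)].
Proof.
have E0 : base (shift 0%R (word i j f0)) = pos (i + 1) j.
  by rewrite -permM -[shift _]expg1 -[(_ ^+ 1)%g](mulg1 _) -(expg0 (shift 1%R)) wordD addn0.
have E1 : base (shift 1%R (word i j f0)) = pos i (j + 1).
  by rewrite -permM -[shift _]expg1 -[(_ ^+ 1)%g](mul1g _) -(expg0 (shift 0%R)) wordD addn0.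
have E2 : base (shift 2%R (word i j f0)) = pos (i + N.-1) (j + N.-1).
  by rewrite -permM shift2_word wordD.
apply/arc_pos/or3P => [[k ->]|].
  by case: (ord3_cases k) => ->; rewrite ?E0 ?E1 ?E2 eqxx;
     [constructor 1 | constructor 2 | constructor 3].
by case=> /eqP ->; [exists 0%R | exists 1%R | exists 2%R].
Qed.

Lemma subZp_eq (n : nat) (u v : 'I_n.+1) (c : nat) :
  ((v - u)%R == inZp c) = (v == u + c %[mod n.+1]).
Proof.
rewrite GRing.subr_eq -val_eqE /= modnDml addnC.
by rewrite [in RHS]modn_small.
Qed.

Lemma order_predK : N.-1.+1 = N.
Proof. exact: prednK order_gt0N. Qed.

Lemma period_mod (a b : nat) : N %| N.-1 * b + a -> a = b %[mod N].
Proof.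
move=> d; rewrite -(modnMDl b a) mulnC -{1}order_predK mulSn -addnA addnC.
by rewrite -modnDml (eqP d) add0n.
Qed.

Lemma iso_grid :
  (forall i j, pos i j = pos 0 0 -> N %| i /\ N %| j) -> digraph_iso e (CayZnZn N).
Proof.
move=> free.
have pos_inj i j i' j' : pos i j = pos i' j' -> i = i' %[mod N] /\ j = j' %[mod N].
  move=> E; have [] := free (N.-1 * i' + i) (N.-1 * j' + j).
    have := congr1 (word (N.-1 * i') (N.-1 * j')) (pos_eq E).
    rewrite -!permM !wordD ![_ + N.-1 * _]addnC -!mulSnr order_predK /pos => ->.
    by congr (base (fun_of_perm _ _)); apply: word_mod; rewrite mod0n modnMr.
  by move=> /period_mod -> /period_mod ->.
pose psi (u : 'I_N.-1.+1 * 'I_N.-1.+1) := pos u.1 u.2.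
have ltN (i : 'I_N.-1.+1) : i %% N = i.
  by rewrite modn_small //; apply: leq_trans (ltn_ord i) _; rewrite order_predK.
apply: (@iso_of_bij _ _ psi).
- move=> [u1 u2] [v1 v2] /pos_inj[/=]; rewrite !ltN => E1 E2.
  by congr (_, _); apply: val_inj.
- move=> y; have [i [j ->]] := pos_onto y; exists (inZp i, inZp j).
  by rewrite /psi /pos /=; congr (base (fun_of_perm _ _));
     apply: word_mod; rewrite order_predK modn_mod.
have modE (a b : nat) : (a == b %[mod N.-1.+1]) = (a == b %[mod N]).
  by rewrite order_predK.
have posE i j i' j' : (pos i j == pos i' j') = (i == i' %[mod N]) && (j == j' %[mod N]).
  apply/eqP/andP => [/pos_inj[-> ->] //|[/eqP E1 /eqP E2]].
  by rewrite /pos (word_mod E1 E2).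
move=> [u1 u2] [v1 v2]; rewrite CayZnZnE !inE /= !xpair_eqE !subZp_eq arc_posE.
by rewrite !modE subn1 !addn0 /psi !posE -orbA.
Qed.

(** * The one-dimensional case: a line over the field with N elements *)

Section Line.
Import GRing.Theory.
Variable w : nat.
Hypothesis shift1_w : shift 1%R f0 = (shift 0%R ^+ w)%g f0.

Lemma pos_line (i j : nat) : pos i j = pos (i + w * j) 0.
Proof.
have E : (shift 1%R ^+ j)%g f0 = (shift 0%R ^+ (w * j))%g f0.
  elim: j => [|j IHj]; first by rewrite muln0 !expg0.
  rewrite expgSr permM IHj -permM -[shift 1%R]expg1 shiftX_comm permM expg1 shift1_w.
  by rewrite -permM -expgD mulnS.
by rewrite /pos /word expg0 mulg1 shiftX_comm permM E -permM -expgD addnC.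
Qed.

Definition line (x : 'F_N) : V := pos x 0.

Lemma line_nat (n : nat) : line n%:R%R = pos n 0.
Proof.
rewrite /line /pos val_Fp_nat ?order_prime //; congr (base (fun_of_perm _ _)).
by apply: word_mod; rewrite ?modn_mod.
Qed.

Lemma line_inj : injective line.
Proof.
move=> x y /pos_eq E; apply: val_inj; have ltN (z : 'F_N) : z < N.
  by have := ltn_ord z; rewrite [X in _ < X]Fp_cast ?order_prime.
rewrite /= -[LHS](modn_small (ltN x)) -[RHS](modn_small (ltN y)).
apply: period_mod; apply: (@shift_order 0%R _ f0).
have := congr1 (word (N.-1 * y) 0) E.
rewrite -!permM !wordD addn0 -mulSn order_predK [(_ + N.-1 * _)%N]addnC.
by rewrite /word !expg0 !mulg1 expgM shiftX_order expg1n perm1 => ->.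
Qed.

Lemma line_onto (y : V) : exists x, y = line x.
Proof.
by have [i [j ->]] := pos_onto y; exists (i + w * j)%:R%R; rewrite pos_line line_nat.
Qed.

Local Open Scope ring_scope.

Definition slope (k : 'I_3) : 'F_N := nth 0 [:: 1; w%:R; - 1 - w%:R] k.

Lemma shift_line (k : 'I_3) (m : nat) (x : 'F_N) :
  base ((shift k ^+ m)%g (word x 0 f0)) = line (x + m%:R * slope k).
Proof.
have predE : (N.-1)%:R = - 1 :> 'F_N.
  apply/eqP; rewrite -subr_eq0 opprK natr1 order_predK.
  by apply/eqP/val_inj; rewrite /= val_Fp_nat ?order_prime // modnn.
have E i j : shift k = word i j -> i%:R + w%:R * j%:R = slope k ->
    base ((shift k ^+ m)%g (word x 0 f0)) = line (x + m%:R * slope k).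
  move=> -> <-; rewrite wordX -permM wordD add0n -/(pos _ _) pos_line -line_nat.
  congr line; rewrite !natrD !natrM natr_Zp; by ring.
case: (ord3_cases k) E => -> E.
- by apply: (E 1%N 0%N); rewrite /word ?expg1 ?expg0 ?mulg1 ?mulr0 ?addr0.
- by apply: (E 0%N 1%N); rewrite /word ?expg1 ?expg0 ?mul1g ?mulr1 ?add0r.
- by apply: (E N.-1 N.-1); rewrite ?shift2_word // predE mulrN1.
Qed.

Lemma walks_line (m : nat) (x y : 'F_N) :
  reflect (exists k, y = x + m%:R * slope k) (0 < walks m (line x) (line y))%N.
Proof.
apply: (iffP (walks_pos _ _ _ _)) => -[k E]; exists k.
  by apply: line_inj; rewrite E shift_line.
by rewrite shift_line E.
Qed.

Lemma arc_line (x y : 'F_N) :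
  reflect (exists k, y = x + slope k) (e (line x) (line y)).
Proof.
apply: (iffP (arc_pos _ _ _)) => -[k E]; exists k.
  by apply: line_inj; rewrite E -[shift k]expg1 shift_line mul1r.
by rewrite -[shift k]expg1 shift_line mul1r E.
Qed.

Lemma slope_neq0 (k : 'I_3) : slope k != 0.
Proof.
have /arc_neq : e (line 0) (line (slope k)) by apply/arc_line; exists k; rewrite add0r.
by apply: contraNneq => ->.
Qed.

Lemma slope_inj : injective slope.
Proof.
move=> k l kl; apply: (@dir_inj (word 0 0 f0)); rewrite -!base_step -!shiftE.
have := shift_line k 1 0; have := shift_line l 1 0.
by rewrite !expg1 kl => -> ->.
Qed.

(* The straight w-walks form a class function, and one of them (along the slope 1)
   ends like the arc of slope w; hence so do all arcs, and w permutes the slopes. *)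
Lemma slope_root : (w%:R : 'F_N) ^+ 2 + w%:R + 1 = 0.
Proof.
set W : 'F_N := w%:R.
have cw : class_fun (fun x y => 0 < walks w x y)%N.
  by apply: class_fun_comp (fun n => 0 < n)%N _ (class_fun_walks w).
have eW : e (line 0) (line W) by apply/arc_line; exists 1; rewrite add0r.
have wW : (0 < walks w (line 0%R) (line W))%N.
  by apply/walks_line; exists 0; rewrite add0r mulr1.
have e1 : e (line 0) (line 1) by apply/arc_line; exists 0; rewrite add0r.
have d5 x : (degree e x <= 5)%N by rewrite degree_arc.
have /walks_line[k] := class_fun_sub class_fun_arc cw e_irr d5 eW wW e1.
rewrite add0r -/W; case: (ord3_cases k) => -> E; last 1 first.
- by rewrite [X in _ + X]E /slope /= -/W; ring.
- have W1 : slope 1 = slope 0 by rewrite /slope /= [RHS]E /slope /= mulr1.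
  by have := slope_inj W1.
(* In the remaining case W^2 = 1, the root W = 1 repeats the slope 1 and W = -1 makes the third
   slope 0. *)
have /eqP : (W - 1) * (W + 1) = 0.
  have -> : (W - 1) * (W + 1) = W * slope 1 - 1 by rewrite /slope /= -/W; ring.
  by rewrite -E subrr.
rewrite mulf_eq0 => /orP[|W1].
  rewrite subr_eq0 => /eqP W1; have W1' : slope 1 = slope 0 by [].
  by have := slope_inj W1'.
by have := slope_neq0 2%:R; rewrite /slope /= -/W -opprD addrC oppr_eq0 W1.
Qed.


Lemma order_gt6 : (6 < N)%N.
Proof.
apply: leq_trans (card_vertices (base f0)) _.
have /fin_all_exists[phi phiP] := line_onto.
rewrite -(card_Fp order_prime); apply: (@leq_card _ _ phi) => x y E.
by rewrite (phiP x) E -phiP.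
Qed.

(* The pair (a, b) encodes a w + b; a^2 - a b + b^2 is the Eisenstein norm. *)
Definition eis (p : int * int) : 'F_N := p.1%:~R * w%:R + p.2%:~R.

Definition eis_norm (p : int * int) : nat := absz (p.1 ^+ 2 - p.1 * p.2 + p.2 ^+ 2).

Lemma eisD (p q : int * int) : eis p + eis q = eis (p.1 + q.1, p.2 + q.2).
Proof. by rewrite /eis /= !intrD; ring. Qed.

Lemma eisB (p q : int * int) : eis p - eis q = eis (p.1 - q.1, p.2 - q.2).
Proof. by rewrite /eis /= !intrB; ring. Qed.

Lemma eis_eq0 (p : int * int) : eis p = 0 -> (N %| eis_norm p)%N.
Proof.
case: p => a b; rewrite /eis /eis_norm /= => ab0.
have z0 : (a ^+ 2 - a * b + b ^+ 2)%:~R = 0 :> 'F_N.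
  rewrite intrD intrB intrM !rmorphXn /=.
  (* The factor b - a w - a is the conjugate of a w + b, since w^2 = - w - 1. *)
  transitivity (a%:~R ^+ 2 * ((w%:R : 'F_N) ^+ 2 + w%:R + 1)
      + (a%:~R * w%:R + b%:~R) * (b%:~R - a%:~R * w%:R - a%:~R)); first by ring.
  by rewrite slope_root ab0 mulr0 mul0r addr0.
move: (_ + _) z0 => z z0; have : (absz z)%:R = 0 :> 'F_N.
  case: z z0 => n //; rewrite NegzE mulrNz => /eqP.
  by rewrite oppr_eq0 => /eqP.
by move/(congr1 val); rewrite /= val_Fp_nat ?order_prime // => /eqP.
Qed.

Definition slopes : seq (int * int) := [:: (0, 1); (1, 0); (- 1, - 1)].

(** The displacements of walks with at most two arcs. *)
Definition short : seq (int * int) :=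
  (0, 0) :: slopes ++ [seq (p.1 + q.1, p.2 + q.2) | p <- slopes, q <- slopes].

Lemma slope_eis (k : 'I_3) : exists2 p, p \in slopes & slope k = eis p.
Proof.
rewrite /slope /eis; case: (ord3_cases k) => ->.
- by exists (0, 1) => //=; rewrite mul0r add0r.
- by exists (1, 0) => //=; rewrite mul1r addr0.
by exists (- 1, - 1) => //=; rewrite mulrN1z; ring.
Qed.

Lemma short_dist (x y : 'F_N) :
  (dist e (line x) (line y) < 3)%N -> exists2 p, p \in short & y - x = eis p.
Proof.
have [p [pp lp <-]] := dist_attained (e_wdr.1 (line x) (line y)).
case: p pp lp => [|u [|v [|//]]] /=.
- by move=> _ /line_inj -> _; exists (0, 0); rewrite // /eis /= mul0r add0r subrr.
- rewrite andbT => + E; rewrite E => /arc_line[k ->] _.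
  have [p pS ->] := slope_eis k; exists p; last by rewrite addrC addKr.
  by rewrite inE mem_cat pS orbT.
case/and3P => + + _ E; have [t ut] := line_onto u; rewrite E ut.
move=> /arc_line[k ->] /arc_line[l ->] _.
have [p pS ->] := slope_eis k; have [q qS ->] := slope_eis l.
exists (p.1 + q.1, p.2 + q.2); last by rewrite -eisD; ring.
by rewrite inE mem_cat [X in [|| _, _ | X]](_ : _ = true) ?orbT //; apply: allpairs_f.
Qed.

Section LongLine.
Hypotheses (N7 : N != 7%N) (N13 : N != 13%N).

(** The listed norms are those met below; a prime above 6 other than 7 and 13 divides none of
    them. *)
Lemma eis_neq0 (p : int * int) : eis_norm p \in [:: 1; 3; 4; 7; 13]%N -> eis p != 0.
Proof.
move=> pn; apply/eqP => /eis_eq0 dN; move: pn dN; have N6 := order_gt6.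
rewrite !inE => /orP[|/or4P[]] /eqP ->; try by move/dvdn_leq => /(_ isT); lia.
by rewrite dvdn_prime2 ?order_prime // (negPf N13).
Qed.

Lemma dist_line3 (x : 'F_N) (d : int * int) : d \in [:: (1, 2); (- 1, - 2)] ->
  dist e (line x) (line (x + eis d)) = 3.
Proof.
move=> dd; apply/eqP; rewrite eqn_leq; apply/andP; split; last first.
  rewrite leqNgt; apply/negP => /short_dist[p pS]; rewrite addrC addKr => E.
  have : eis (d.1 - p.1, d.2 - p.2) != 0.
    have all_short : all (fun d => all (fun p => eis_norm (d.1 - p.1, d.2 - p.2)
        \in [:: 1; 3; 4; 7; 13]%N) short) [:: (1, 2); (- 1, - 2)] by [].
    by apply: eis_neq0; exact: (allP (allP all_short d dd)).
  by rewrite -eisB E subrr eqxx.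
have step k l m : slope k + slope l + slope m = eis d ->
    (dist e (line x) (line (x + eis d)%R) <= 3)%N.
  move=> <-; pose y := x + slope k; pose z := y + slope l.
  have xy : e (line x) (line y) by apply/arc_line; exists k.
  have yz : e (line y) (line z) by apply/arc_line; exists l.
  have zt : e (line z) (line (z + slope m)) by apply/arc_line; exists m.
  by rewrite !addrA; have := @dist_min _ e (line x) [:: line y; line z; line (z + slope m)];
    rewrite /= xy yz zt => /(_ isT).
(* The two sums are 2 + w = 1 + 1 + w and - 2 - w = (- 1 - w) + w + (- 1 - w). *)
move: dd; rewrite !inE => /orP[] /eqP dE.
  by apply: (step 0 0 1); rewrite dE /slope /eis /=; ring.
by apply: (step 2%:R 1 2%:R); rewrite dE /slope /eis /=; ring.
Qed.

(* The vertices 2 + w and -(2 + w) both lie at two-way distance (3, 3) from 0, but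
   only the first is the end of a straight (2 + w)-walk from 0. *)
Lemma long_line_absurd : False.
Proof.
pose d : int * int := (1, 2); pose d' : int * int := (- 1, - 2).
have dd' : eis d' = - eis d by rewrite /eis /=; ring.
have d3 := @dist_line3 0 d isT; have d3' := @dist_line3 0 d' isT.
have d3r := @dist_line3 (eis d) d' isT; have d3r' := @dist_line3 (eis d') d isT.
rewrite !add0r in d3 d3'; rewrite dd' subrr in d3r; rewrite dd' addNr -dd' in d3r'.
have E : dist2 e (line 0) (line (eis d)) = dist2 e (line 0) (line (eis d')).
  by rewrite /dist2 d3 d3' d3r d3r'.
have : (0 < walks (w + 2) (line 0%R) (line (eis d)))%N.
  by apply/walks_line; exists 0; rewrite add0r mulr1 natrD /eis /= mul1r.
rewrite (class_fun_walks _ E) => /walks_line[k]; rewrite add0r dd'.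
have -> : (w + 2)%:R = eis d by rewrite natrD /eis /= mul1r.
(* Cancelling 2 + w leaves a slope equal to -1, but -1 minus a slope has norm 4 or 1. *)
move/eqP; rewrite -subr_eq0 -mulrN1 -mulrBr mulf_eq0 (negPf (@eis_neq0 d isT)) /=.
have [p pS ->] := slope_eis k.
have -> : - 1 = eis (0, - 1) by rewrite /eis /=; ring.
rewrite eisB; apply/negP; apply: eis_neq0.
have all_slopes : all (fun p => eis_norm (0 - p.1, - 1 - p.2)
  \in [:: 1; 3; 4; 7; 13]%N) slopes by [].
exact: (allP all_slopes).
Qed.

End LongLine.

Lemma line_order : (N == 7)%N || (N == 13)%N.
Proof.
have [//|] := boolP ((N == 7)%N || (N == 13)%N); rewrite negb_or => /andP[N7 N13].
by case: (long_line_absurd N7 N13).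
Qed.

Lemma arc_lineE (x y : 'F_N) :
  e (line x) (line y) = (y - x \in [:: 1; w%:R; - 1 - w%:R]).
Proof.
apply/arc_line/idP => [[k ->]|].
  by rewrite addrC addKr /slope; case: (ord3_cases k) => -> /=; rewrite !inE eqxx ?orbT.
have yE : y = x + (y - x) by rewrite addrC subrK.
rewrite !inE => /or3P[] /eqP E; rewrite {}E in yE.
- by exists 0.
- by exists 1.
by exists 2%:R.
Qed.

End Line.

(** A variable p allows p = 7 to be substituted in the type of [psi]. Both roots 2 and 4 of the
    quadratic give the same three slopes. *)
Lemma iso_Cay7 (p : nat) (psi : 'F_p -> V) (W : 'F_p) : p = 7 ->
  injective psi -> (forall y, exists x, y = psi x) -> (W ^+ 2 + W + 1 = 0)%R ->
  (forall x y, e (psi x) (psi y) = (y - x \in [:: 1; W; - 1 - W])%R) ->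
  digraph_iso e Cay7.
Proof.
move=> p7; subst p => psi_inj psi_onto W0 psiE.
apply: (@iso_of_bij 'Z_7 _ psi) => // u v; rewrite psiE Cay7E.
have : W \in [:: 2%:R; 4%:R]%R.
  by move: W0 {psiE}; case: W => -[|[|[|[|[|[|[|//]]]]]]].
rewrite !inE => /orP[] /eqP ->.
  by rewrite -orbA; congr [|| _, _ | _ == _]; apply: val_inj.
rewrite -orbA [(_ == 4%:R)%R || _]orbC; congr [|| _, _ == _ | _]; exact: val_inj.
Qed.

Lemma iso_Cay13 (p : nat) (psi : 'F_p -> V) (W : 'F_p) : p = 13 ->
  injective psi -> (forall y, exists x, y = psi x) -> (W ^+ 2 + W + 1 = 0)%R ->
  (forall x y, e (psi x) (psi y) = (y - x \in [:: 1; W; - 1 - W])%R) ->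
  digraph_iso e Cay13.
Proof.
move=> p13; subst p => psi_inj psi_onto W0 psiE.
apply: (@iso_of_bij 'Z_13 _ psi) => // u v; rewrite psiE Cay13E.
have : W \in [:: 3%:R; 9%:R]%R.
  by move: W0 {psiE}; case: W => -[|[|[|[|[|[|[|[|[|[|[|[|[|//]]]]]]]]]]]]].
rewrite !inE => /orP[] /eqP ->.
  by rewrite -orbA; congr [|| _, _ | _ == _]; apply: val_inj.
rewrite -orbA [(_ == 9%:R)%R || _]orbC; congr [|| _, _ == _ | _]; exact: val_inj.
Qed.

Lemma line_exists (i j : nat) : pos i j = pos 0 0 -> ~~ ((N %| i) && (N %| j)) ->
  exists w, shift 1%R f0 = (shift 0%R ^+ w)%g f0.
Proof.
move=> E ndvd; have word_f0 : word i j f0 = f0 by rewrite (pos_eq E) word00 perm1.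
have Nj : ~~ (N %| j).
  apply: contra ndvd => Nj; rewrite Nj andbT; apply: (@shift_order 0%R _ f0).
  have W0 : word i j = (shift 0%R ^+ i)%g.
    by rewrite (@word_mod _ _ i 0) /word ?expg0 ?mulg1 // mod0n; apply/eqP.
  by rewrite -W0 word_f0.
(* Here a is - 1 / j modulo N, so the a-th power of the relation solves for [shift 1] in terms of
   [shift 0] at [f0]. *)
have [a _] := Bezoutl j order_gt0N.
have /eqP -> : coprime N j by rewrite prime_coprime ?order_prime.
move=> Na; exists (i * a).
have wordX_f0 : word (i * a) (j * a) f0 = f0.
  by rewrite -wordX permX; elim: a {Na} => //= a ->.
rewrite -[in LHS]wordX_f0 -permM -[shift 1%R](_ : word 0 1 = _); last first.
  by rewrite /word expg0 mul1g expg1.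
rewrite wordD (@word_mod _ _ (i * a) 0) ?addn0 //; first by rewrite /word expg0 mulg1.
by rewrite mod0n; apply/eqP; rewrite addnC mulnC.
Qed.

Lemma classification :
  [\/ digraph_iso e Cay7, digraph_iso e Cay13 | digraph_iso e (CayZnZn N)].
Proof.
have [/forallP free|] := boolP [forall i : 'I_N, forall j : 'I_N,
    (pos i j == pos 0 0) ==> (N %| i) && (N %| j)].
  constructor 3; apply: iso_grid => i j.
  have -> : pos i j = pos (i %% N) (j %% N).
    by rewrite /pos; congr (base (fun_of_perm _ _)); apply: word_mod; rewrite modn_mod.
  have /forallP/(_ (Ordinal (ltn_pmod j order_gt0N))) :=
    free (Ordinal (ltn_pmod i order_gt0N)).
  by move=> /implyP H /eqP /H /=; rewrite /dvdn !modn_mod => /andP.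
rewrite negb_forall => /existsP[i]; rewrite negb_forall => /existsP[j].
rewrite negb_imply => /andP[/eqP E ndvd].
have [w wE] := line_exists E ndvd.
have [/eqP N7|/eqP N13] := orP (line_order wE).
  by constructor 1; exact: iso_Cay7 N7 line_inj (line_onto wE) (slope_root wE) (arc_lineE wE).
by constructor 2; exact: iso_Cay13 N13 line_inj (line_onto wE) (slope_root wE) (arc_lineE wE).
Qed.

End Coordinates.
End ClassFunctions.

Theorem corollary1p2 (V : finType) (e : rel V)
  (e_simple : simple_digraph e)
  (e_wdr : weakly_distance_regular e)
  (e_comm : commutative_digraph e)
  (e_prim : primitive_digraph e)
  (e_val : has_valency e 3)
  (e_girth : 2 < girth e) :
  [\/ digraph_iso e Cay7,
      digraph_iso e Cay13
    | exists n : nat,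
        [/\ 0 < n, ~ (3 %| n /\ n <> 3) & digraph_iso e (CayZnZn n)] ].
Proof.
case: e_simple => /card_gt0P[x _] e_irr.
have [f0 _] := frame_ex e_val e_girth x.
pose N := #[shift e_wdr e_comm e_irr e_prim e_val e_girth 0%R]%g.
have N_prime := order_prime f0 (erefl N).
case: (classification f0 (erefl N)) => iso; [by constructor 1 | by constructor 2 |].
constructor 3; exists N; split=> //; first exact: prime_gt0.
(* The order N is prime, so it is divisible by 3 only if it equals 3. *)
by case; rewrite dvdn_prime2 // => /eqP <-.
Qed.
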